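(* Let $\underline{T}=(T_1,\ldots,T_d)$ be a row contraction on a Hilbert space $\mathcal{H}_T$ with finite dimensional defect space $\mathcal{D}_T$. Let $\mathcal{U},\mathcal{Y}$ be Hilbert spaces and let $$W=\begin{bmatrix} \underline{T}^* & F \\ G & H \end{bmatrix}=\begin{bmatrix} T_1^* & F_1 \\ \vdots & \vdots \\ T_d^* & F_d \\ G & H \end{bmatrix}:\mathcal{H}_T\oplus\mathcal{U}\to\mathcal{H}_T^d\oplus\mathcal{Y}$$ be a co-isometric observable colligation with basic operator $\underline{T}^*$. If $\dim\mathcal{U}=\dim\mathcal{D}_T$, then $W$ has the form $$W=\begin{bmatrix} I & 0 \\ 0 & \gamma' \end{bmatrix}\begin{bmatrix} \underline{T}^* & D_T\tilde\sigma \\ D_{*,T} & -\underline{T}\tilde\sigma \end{bmatrix},$$ where $\gamma'$ is a co-isometric contraction from $\mathcal{D}_{*,T}$ to $\mathcal{Y}$ and $\tilde\sigma$ is a unitary operator from $\mathcal{U}$ to $\mathcal{D}_T$.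
   Context: A tuple $\underline{T}=(T_1,\ldots,T_d)$ of bounded operators on a Hilbert space $\mathcal{H}$ is a row contraction if $\sum_{i=1}^d T_iT_i^*\le I$; we view $\underline{T}=[T_1\ \cdots\ T_d]:\mathcal{H}^d:=\bigoplus_{i=1}^d\mathcal{H}\to\mathcal{H}$. $D_T=(I-\underline{T}^*\underline{T})^{1/2}$ on $\mathcal{H}^d$, $D_{*,T}=(I-\underline{T}\,\underline{T}^* )^{1/2}$ on $\mathcal{H}$, $\mathcal{D}_T=\overline{\mathrm{ran}}\,D_T$, $\mathcal{D}_{*,T}=\overline{\mathrm{ran}}\,D_{*,T}$ (note $\underline{T}\mathcal{D}_T\subseteq\mathcal{D}_{*,T}$). A colligation is an operator $W=\begin{bmatrix} X & F \\ G & H \end{bmatrix}:\mathcal{H}_1\oplus\mathcal{H}_2\to\mathcal{H}_1^d\oplus\mathcal{H}_3$ with $X=(X_1,\ldots,X_d)^t$ (the basic operator) written as a column; $\mathcal{H}_1,\mathcal{H}_2,\mathcal{H}_3$ are the state, input and output spaces. It is co-isometric if $WW^*=I$. It is observable if the observability operator $\mathcal{H}_1\ni x\mapsto\sum_\alpha e_\alpha\otimes GX_{\alpha_n}\cdots X_{\alpha_1}x\in\Gamma\otimes\mathcal{H}_3$ is injective (sum over all finite words $\alpha=(\alpha_1,\ldots,\alpha_n)$ in $\{1,\ldots,d\}$ including the empty word, $\Gamma$ the full Fock space over $\mathbb{C}^d$ with orthonormal basis $e_\alpha=e_{\alpha_1}\otimes\cdots\otimes e_{\alpha_n}$); equivalently,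 $GX_{\alpha_n}\cdots X_{\alpha_1}x=0$ for all words $\alpha$ implies $x=0$. *)

(* Defs.v *)
From HB Require Import structures.
From mathcomp Require Import all_boot all_order all_algebra.
From mathcomp Require Import all_classical all_reals all_analysis.
From mathcomp Require Import complex.

Set Implicit Arguments.
Unset Strict Implicit.
Unset Printing Implicit Defensive.

Import Order.TTheory GRing.Theory Num.Theory.
Import numFieldNormedType.Exports.

Local Open Scope classical_set_scope.
Local Open Scope ring_scope.

(* Complex Hilbert spaces: complete normed modules over R[i] whose norm comes
   from an inner product. As in sesquilinear.v, the inner product is linear in
   its first argument and conjugate-linear in the second one. *)
HB.mixin Record CompleteNormedModule_isHilbert (R : realType) H
    & CompleteNormedModule R[i] H := {
  dotp : {dot H for (@Num.conj R[i])};
  dotpxx : forall x : H, dotp x x = `|x| ^+ 2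
}.

#[short(type="hilbertType")]
HB.structure Definition Hilbert (R : realType) :=
  {H of CompleteNormedModule R[i] H & CompleteNormedModule_isHilbert R H}.

Section DotNorm.
Variables (R : realType) (V : lmodType R[i]) (f : {dot V for (@Num.conj R[i])}).

Definition dot_norm (x : V) : R[i] := sqrtC (f x x).

Lemma dot_cauchy_schwarz x y : `|f x y| ^+ 2 <= f x x * f y y.
Proof.
have [->|y0] := eqVneq y 0; first by rewrite !linear0r normr0 expr0n.
have fy0 : f y y != 0 by rewrite dnorm_eq0.
pose a := f x y / f y y; pose z := x - a *: y.
have oz : f z y = 0 by rewrite /z linearBl/= linearZl_LR/= divfK// subrr.
have -> : x = z + a *: y by rewrite subrK.
rewrite linearDl/= oz add0r linearZl_LR/= normrM (ger0_norm (dnorm_ge0 _ _)).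
rewrite exprMn hnormDd/=; last by rewrite linearZr_LR/= oz mulr0.
rewrite (dnormZ f _ y) mulrDl -[X in _ <= _ + X]mulrA -expr2 lerDr.
by rewrite mulr_ge0.
Qed.

Lemma dot_norm_ge0 x : 0 <= dot_norm x.
Proof. by rewrite sqrtC_ge0 dnorm_ge0. Qed.

Lemma sqr_dot_norm x : dot_norm x ^+ 2 = f x x.
Proof. exact: sqrtCK. Qed.

Lemma ler_dot_normD x y : dot_norm (x + y) <= dot_norm x + dot_norm y.
Proof.
rewrite -ler_sqr ?nnegrE ?addr_ge0 ?dot_norm_ge0// sqrrD !sqr_dot_norm.
rewrite (dnormD f)/= [leRHS]addrAC lerD2l.
have -> : f x y + (f x y)^* = 'Re (f x y) *+ 2.
  by rewrite ReE -mulr_natr divfK// pnatr_eq0.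
rewrite -mulr_natl -[leRHS]mulr_natl ler_pM2l ?ltr0n// (le_trans (leif_Re_Creal _))//.
rewrite -ler_sqr ?nnegrE ?mulr_ge0 ?dot_norm_ge0// exprMn !sqr_dot_norm.
exact: dot_cauchy_schwarz.
Qed.

Lemma dot_normZ a x : dot_norm (a *: x) = `|a| * dot_norm x.
Proof.
by rewrite /dot_norm (dnormZ f) rootCMl ?mulr_ge0 ?exprn_ge0// sqrCK.
Qed.

Lemma dot_norm_eq0 x : dot_norm x = 0 -> x = 0.
Proof. by move=> /eqP; rewrite sqrtC_eq0 dnorm_eq0 => /eqP. Qed.

End DotNorm.

HB.factory Record Lmodule_isHilbert (R : realType) H & GRing.Lmodule R[i] H := {
  dot : {dot H for (@Num.conj R[i])};
  dot_complete : forall F : set_system H, ProperFilter F ->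
    (forall e : R[i], 0 < e -> exists x, F [set y | dot_norm dot (x - y) < e]) ->
    exists l, forall e : R[i], 0 < e -> F [set y | dot_norm dot (l - y) < e]
}.

HB.builders Context R H & Lmodule_isHilbert R H.

HB.instance Definition _ := @Lmodule_isNormed.Build R[i] H
  (dot_norm dot) (ler_dot_normD dot) (dot_normZ dot) (@dot_norm_eq0 _ _ dot).

Let complete_subproof (F : set_system H) : ProperFilter F -> cauchy F -> cvg F.
Proof.
move=> FF /cauchyP Fc.
have [e e0|l Hl] := dot_complete FF.
  by have [x Fx] := Fc e e0; exists x; move: Fx; rewrite -ball_normE.
apply/cvg_ex; exists l; apply/fcvgrPdist_lt => e e0; exact: Hl.
Qed.

HB.instance Definition _ := Uniform_isComplete.Build H complete_subproof.

Let dotpxx_subproof (x : H) : dot x x = `|x| ^+ 2.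
Proof. by rewrite -(sqr_dot_norm dot). Qed.

HB.instance Definition _ :=
  CompleteNormedModule_isHilbert.Build R H dotpxx_subproof.

HB.end.

Local Notation "''[' u , v ]" := (dotp u v) : ring_scope.

(* The Hilbert direct sum. The alias keeps it apart from the product type,
   which the library equips with the sup norm. *)
Section DirectSum.
Variables (R : realType) (H K : hilbertType R).

Definition dsum : Type := (H * K)%type.
HB.instance Definition _ := GRing.Lmodule.copy dsum (H * K)%type.

Definition dsum_dot (x y : dsum) : R[i] := '[x.1, y.1] + '[x.2, y.2].

Let dsum_dotBl (y : dsum) : zmod_morphism (dsum_dot ^~ y).
Proof.
by move=> x x'; rewrite /dsum_dot/= !linearBl/= addrACA opprD.
Qed.

Let dsum_dotBr (x : dsum) : zmod_morphism (dsum_dot x).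
Proof. by move=> y y'; rewrite /dsum_dot/= !linearBr/= addrACA opprD. Qed.

Let dsum_dotZl (y : dsum) : scalable_for *%R (dsum_dot ^~ y).
Proof. by move=> a x; rewrite /dsum_dot/= !linearZl_LR/= mulrDr. Qed.

Let dsum_dotZr (x : dsum) : scalable_for (Num.conj \; *%R) (dsum_dot x).
Proof. by move=> a y; rewrite /dsum_dot/= !linearZr_LR/= mulrDr. Qed.

HB.instance Definition _ := isBilinear.Build R[i] dsum dsum R[i]
  *%R (Num.conj \; *%R) dsum_dot dsum_dotBl dsum_dotBr dsum_dotZl dsum_dotZr.

Let dsum_dotC (x y : dsum) :
  dsum_dot x y = (-1) ^+ false * (dsum_dot y x)^*.
Proof.
by rewrite mul1r /dsum_dot rmorphD/= (hermC dotp x.1) (hermC dotp x.2) !mul1r.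
Qed.

HB.instance Definition _ := isHermitianSesquilinear.Build R[i] dsum
  false Num.conj dsum_dot dsum_dotC.

Let dsum_dot_gt0 (x : dsum) : x != 0 -> 0 < dsum_dot x x.
Proof.
case: x => x y; rewrite /dsum_dot/= lt_def addr_ge0 ?dnorm_ge0// andbT.
by rewrite paddr_eq0 ?dnorm_ge0// !dnorm_eq0 -pair_eqE.
Qed.

HB.instance Definition _ := isDotProduct.Build R[i] dsum dsum_dot dsum_dot_gt0.

Let ler_dsum_norm (x : dsum) : `|x.1| <= dot_norm dsum_dot x
   /\ `|x.2| <= dot_norm dsum_dot x.
Proof.
by split; rewrite -ler_sqr ?nnegrE ?dot_norm_ge0// sqr_dot_norm -dotpxx
  ?lerDl ?lerDr dnorm_ge0.
Qed.

Let dsum_norm_le (x : dsum) : dot_norm dsum_dot x <= `|x.1| + `|x.2|.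
Proof.
rewrite -ler_sqr ?nnegrE ?dot_norm_ge0 ?addr_ge0// sqr_dot_norm sqrrD.
rewrite [leLHS](_ : _ = `|x.1| ^+ 2 + `|x.2| ^+ 2); last by rewrite -!dotpxx.
by rewrite addrAC lerDl mulrn_wge0 ?mulr_ge0.
Qed.

Let dsum_complete (F : set_system dsum) : ProperFilter F ->
    (forall e : R[i], 0 < e ->
      exists x, F [set y | dot_norm dsum_dot (x - y) < e]) ->
    exists l, forall e : R[i], 0 < e -> F [set y | dot_norm dsum_dot (l - y) < e].
Proof.
move=> FF Fc.
have cv1 : cvg (fst @ F : set_system H).
  apply: cauchy_cvg; apply/cauchyP => e e0; have [x Fx] := Fc e e0.
  exists x.1; rewrite /fmap/=; apply: filterS Fx => y /= yx.
  by rewrite -ball_normE; exact: le_lt_trans (ler_dsum_norm (x - y)).1 yx.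
have cv2 : cvg (snd @ F : set_system K).
  apply: cauchy_cvg; apply/cauchyP => e e0; have [x Fx] := Fc e e0.
  exists x.2; rewrite /fmap/=; apply: filterS Fx => y /= yx.
  by rewrite -ball_normE; exact: le_lt_trans (ler_dsum_norm (x - y)).2 yx.
have /cvg_ex[/= l1 /fcvgrPdist_lt Fl1] := cv1.
have /cvg_ex[/= l2 /fcvgrPdist_lt Fl2] := cv2.
exists (l1, l2) => e e0; have e20 : 0 < e / 2 by rewrite divr_gt0.
have F1 : F [set y | `|l1 - y.1| < e / 2] := Fl1 _ e20.
have F2 : F [set y | `|l2 - y.2| < e / 2] := Fl2 _ e20.
apply: filterS (filterI F1 F2) => y /= [y1 y2].
rewrite (le_lt_trans (dsum_norm_le _))//= [ltRHS](splitr e) ltrD//.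
Qed.

HB.instance Definition _ := Lmodule_isHilbert.Build R dsum dsum_complete.

End DirectSum.

Section Power.
Variables (R : realType) (d : nat) (H : hilbertType R).

Definition hpow : Type := {ffun 'I_d -> H}.
HB.instance Definition _ := GRing.Lmodule.copy hpow {ffun 'I_d -> H}.

Definition hpow_dot (x y : hpow) : R[i] := \sum_(i < d) '[x i, y i].

Let hpow_dotBl (y : hpow) : zmod_morphism (hpow_dot ^~ y).
Proof.
move=> x x'; rewrite /hpow_dot -sumrB; apply: eq_bigr => i _.
by rewrite !ffunE linearBl.
Qed.

Let hpow_dotBr (x : hpow) : zmod_morphism (hpow_dot x).
Proof.
move=> y y'; rewrite /hpow_dot -sumrB; apply: eq_bigr => i _.
by rewrite !ffunE linearBr.
Qed.

Let hpow_dotZl (y : hpow) : scalable_for *%R (hpow_dot ^~ y).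
Proof.
move=> a x; rewrite /hpow_dot mulr_sumr; apply: eq_bigr => i _.
by rewrite !ffunE linearZl_LR.
Qed.

Let hpow_dotZr (x : hpow) : scalable_for (Num.conj \; *%R) (hpow_dot x).
Proof.
move=> a y; rewrite /hpow_dot/= mulr_sumr; apply: eq_bigr => i _.
by rewrite !ffunE linearZr_LR.
Qed.

HB.instance Definition _ := isBilinear.Build R[i] hpow hpow R[i]
  *%R (Num.conj \; *%R) hpow_dot hpow_dotBl hpow_dotBr hpow_dotZl hpow_dotZr.

Let hpow_dotC (x y : hpow) :
  hpow_dot x y = (-1) ^+ false * (hpow_dot y x)^*.
Proof.
rewrite mul1r /hpow_dot rmorph_sum/=; apply: eq_bigr => i _.
by rewrite (hermC dotp) mul1r.
Qed.

HB.instance Definition _ := isHermitianSesquilinear.Build R[i] hpow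
  false Num.conj hpow_dot hpow_dotC.

Let hpow_dot_gt0 (x : hpow) : x != 0 -> 0 < hpow_dot x x.
Proof.
move=> x0; rewrite lt_def /hpow_dot sumr_ge0 => [|i _]; last exact: dnorm_ge0.
rewrite andbT; apply: contra x0 => /eqP sx0; apply/eqP/ffunP => i.
rewrite ffunE; apply/eqP; rewrite -(dnorm_eq0 dotp); apply/eqP.
by apply: (psumr_eq0P _ sx0) => // j _; exact: dnorm_ge0.
Qed.

HB.instance Definition _ := isDotProduct.Build R[i] hpow hpow_dot hpow_dot_gt0.

Let ler_hpow_norm (x : hpow) i : `|x i| <= dot_norm hpow_dot x.
Proof.
rewrite -ler_sqr ?nnegrE ?dot_norm_ge0// sqr_dot_norm -dotpxx.
rewrite [leRHS](bigD1 i)//= lerDl sumr_ge0// => j _; exact: dnorm_ge0.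
Qed.

Let hpow_norm_le (x : hpow) : dot_norm hpow_dot x <= \sum_(i < d) `|x i|.
Proof.
have s0 : 0 <= \sum_(i < d) `|x i| by apply: sumr_ge0.
rewrite -ler_sqr ?nnegrE ?dot_norm_ge0// sqr_dot_norm.
rewrite [leLHS](_ : _ = \sum_(i < d) `|x i| ^+ 2); last first.
  by apply: eq_bigr => i _; rewrite -dotpxx.
have [] : \sum_(i < d) `|x i| ^+ 2 <= (\sum_(i < d) `|x i|) ^+ 2 /\
  0 <= \sum_(i < d) `|x i|; last by [].
elim/big_rec2: _ => [|i a b _ [ab a0]]; first by rewrite expr0n.
rewrite addr_ge0//; split => //.
by rewrite sqrrD lerD// lerDl mulrn_wge0 ?mulr_ge0.
Qed.

Let hpow_complete (F : set_system hpow) : ProperFilter F ->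
    (forall e : R[i], 0 < e ->
      exists x, F [set y | dot_norm hpow_dot (x - y) < e]) ->
    exists l, forall e : R[i], 0 < e -> F [set y | dot_norm hpow_dot (l - y) < e].
Proof.
move=> FF Fc.
have cv i : cvg ((fun x : hpow => x i) @ F : set_system H).
  apply: cauchy_cvg; apply/cauchyP => e e0; have [x Fx] := Fc e e0.
  exists (x i); rewrite /fmap/=; apply: filterS Fx => y /= yx.
  rewrite -ball_normE; apply: le_lt_trans yx.
  by apply: le_trans (ler_hpow_norm _ i); rewrite !ffunE.
pose l : hpow := [ffun i => lim ((fun x : hpow => x i) @ F : set_system H)].
exists l => e e0.
have e20 : 0 < e / d.+1%:R by rewrite divr_gt0.
have Fl i : F [set y | `|l i - y i| < e / d.+1%:R].
  by have /fcvgrPdist_lt/(_ _ e20) := cv i; rewrite ffunE.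
have FFl : F [set y | forall i, `|l i - y i| < e / d.+1%:R].
  exact: (@filter_forall hpow _ (fun i (y : hpow) => `|l i - y i| < e / d.+1%:R) F _ Fl).
apply: filterS FFl => y /= ly.
rewrite (le_lt_trans (hpow_norm_le _))//.
rewrite (@le_lt_trans _ _ (\sum_(i < d) e / d.+1%:R))//.
  by apply: ler_sum => i _; rewrite !ffunE ltW//; have := ly i; rewrite ffunE.
rewrite sumr_const card_ord -[ltLHS]mulr_natr -[ltLHS]mulrA gtr_pMr// mulrC.
by rewrite ltr_pdivrMr ?ltr0Sn// mul1r ltr_nat.
Qed.

HB.instance Definition _ := Lmodule_isHilbert.Build R hpow hpow_complete.

End Power.

Record closed_subspace (R : realType) (H : hilbertType R) := ClosedSubspace {
  subspace_set :> set H;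
  subspace0 : subspace_set 0;
  subspaceP : forall (a : R[i]) x y,
    subspace_set x -> subspace_set y -> subspace_set (a *: x + y);
  subspace_closed : closed subspace_set
}.

Section SubspaceType.
Variables (R : realType) (H : hilbertType R) (S : closed_subspace H).

Definition subspace_pred : {pred H} := fun x => x \in (S : set H).

Record subspace_type := SubspaceElt {
  subspace_val :> H;
  subspace_valP : subspace_val \in subspace_pred
}.

HB.instance Definition _ := [isSub for subspace_val].
HB.instance Definition _ := [Choice of subspace_type by <:].

Let subspace_submod : submod_closed subspace_pred.
Proof.
split; first by rewrite inE; exact: subspace0.
by move=> a x y; rewrite !inE; exact: subspaceP.
Qed.

HB.instance Definition _ :=
  GRing.isSubmodClosed.Build R[i] H subspace_pred subspace_submod.
HB.instance Definition _ := [SubChoice_isSubLmodule of subspace_type by <:].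

Definition subspace_dot (x y : subspace_type) : R[i] := '[val x, val y].

Let subspace_dotBl (y : subspace_type) : zmod_morphism (subspace_dot ^~ y).
Proof. by move=> x x'; rewrite /subspace_dot raddfB linearBl. Qed.

Let subspace_dotBr (x : subspace_type) : zmod_morphism (subspace_dot x).
Proof. by move=> y y'; rewrite /subspace_dot (raddfB val) linearBr. Qed.

Let subspace_dotZl (y : subspace_type) : scalable_for *%R (subspace_dot ^~ y).
Proof. by move=> a x; rewrite /subspace_dot linearZ linearZl_LR. Qed.

Let subspace_dotZr (x : subspace_type) :
  scalable_for (Num.conj \; *%R) (subspace_dot x).
Proof. by move=> a y; rewrite /subspace_dot [val (_ *: _)]linearZ linearZr_LR. Qed.

HB.instance Definition _ := isBilinear.Build R[i]
  subspace_type subspace_type R[i] *%R (Num.conj \; *%R) subspace_dot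
  subspace_dotBl subspace_dotBr subspace_dotZl subspace_dotZr.

Let subspace_dotC (x y : subspace_type) :
  subspace_dot x y = (-1) ^+ false * (subspace_dot y x)^*.
Proof. exact: (hermC dotp). Qed.

HB.instance Definition _ := isHermitianSesquilinear.Build R[i] subspace_type
  false Num.conj subspace_dot subspace_dotC.

Let subspace_dot_gt0 (x : subspace_type) : x != 0 -> 0 < subspace_dot x x.
Proof. by move=> x0; rewrite dnorm_gt0; exact: x0. Qed.

HB.instance Definition _ :=
  isDotProduct.Build R[i] subspace_type subspace_dot subspace_dot_gt0.

Let subspace_norm (x : subspace_type) : dot_norm subspace_dot x = `|val x|.
Proof. by rewrite /dot_norm /= /subspace_dot dotpxx sqrCK. Qed.

Let subspace_complete (F : set_system subspace_type) : ProperFilter F ->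
    (forall e : R[i], 0 < e ->
      exists x, F [set y | dot_norm subspace_dot (x - y) < e]) ->
    exists l, forall e : R[i],
      0 < e -> F [set y | dot_norm subspace_dot (l - y) < e].
Proof.
move=> FF Fc.
have cv : cvg (subspace_val @ F : set_system H).
  apply: cauchy_cvg; apply/cauchyP => e e0; have [x Fx] := Fc e e0.
  exists (val x); rewrite /fmap/=; apply: filterS Fx => y /=.
  by rewrite subspace_norm raddfB -ball_normE.
have /cvg_ex[/= l Fl] := cv.
have Sl : l \in subspace_pred.
  have FS : \forall x \near F, subspace_set S (subspace_val x).
    by apply: nearW => x; have := subspace_valP x; rewrite inE.
  by rewrite inE; exact: (closed_cvg (subspace_set S) (@subspace_closed _ _ S) FS l Fl).
exists (SubspaceElt Sl) => e e0.
have F1 : F [set y : subspace_type | `|l - val y| < e].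
  by move/fcvgrPdist_lt : Fl; exact.
by apply: filterS F1 => y /=; rewrite subspace_norm raddfB.
Qed.

HB.instance Definition _ :=
  Lmodule_isHilbert.Build R subspace_type subspace_complete.

End SubspaceType.

HB.mixin Record isBoundedOp (R : realType) (H K : hilbertType R) (f : H -> K) := {
  bounded_op : exists M : R[i], forall x, `|f x| <= M * `|x|
}.

HB.structure Definition BoundedOp (R : realType) (H K : hilbertType R) :=
  {f of @GRing.Linear R[i] H K *:%R f & isBoundedOp R H K f}.

Notation "''B' ( H , K )" := (@BoundedOp.type _ H K)
  (at level 8, H at level 99, K at level 99, format "''B' ( H ,  K )") : type_scope.

HB.instance Definition _ (R : realType) (H K : hilbertType R) := gen_eqMixin 'B(H, K).
HB.instance Definition _ (R : realType) (H K : hilbertType R) := gen_choiceMixin 'B(H, K).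

Section ZeroOp.
Variables (R : realType) (H K : hilbertType R).
Let null_bounded : exists M : R[i], forall x : H, `|(\0 : H -> K) x| <= M * `|x|.
Proof. by exists 0 => x; rewrite normr0 mul0r. Qed.
HB.instance Definition _ :=
  isBoundedOp.Build R H K (\0 : H -> K) null_bounded.

End ZeroOp.

Definition is_adjoint (R : realType) (H K : hilbertType R)
    (A : H -> K) (B : K -> H) :=
  forall x y, '[A x, y] = '[x, B y].

(* The adjoint is unique, and it exists by the Riesz representation theorem, so
   the default value of xget is irrelevant. *)
Definition adjoint (R : realType) (H K : hilbertType R) (A : 'B(H, K)) : 'B(K, H) :=
  xget (\0 : 'B(K, H)) [set B : 'B(K, H) | is_adjoint A B].

(* In a complex Hilbert space, positivity of the quadratic form of B - A already
   makes B - A self-adjoint; note that `<=` on R[i] compares real parts only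
   for numbers with equal imaginary parts. *)
Definition op_le (R : realType) (H : hilbertType R) (A B : H -> H) :=
  forall x, '[A x, x] <= '[B x, x].

(* The positive square root of A. It is unique, and it exists as soon as A is a
   positive bounded operator; the default value of xget matters for no other A. *)
Definition op_sqrt (R : realType) (H : hilbertType R) (A : H -> H) : 'B(H, H) :=
  xget (\0 : 'B(H, H)) [set B : 'B(H, H) | op_le \0 B /\ B \o B =1 A].

Definition coisometric (R : realType) (H K : hilbertType R) (A : 'B(H, K)) :=
  A \o adjoint A =1 id.

Definition contractive (R : realType) (H K : hilbertType R) (A : H -> K) :=
  forall x, `|A x| <= `|x|.

Definition unitary_op (R : realType) (H K : hilbertType R) (A : 'B(H, K)) :=
  adjoint A \o A =1 id /\ A \o adjoint A =1 id.

Section RangeClosure.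
Variables (R : realType) (H K : hilbertType R) (A : 'B(H, K)).

Let ran0 : closure (range A) 0.
Proof. by apply: subset_closure; exists 0 => //; rewrite linear0. Qed.

Let ranP (a : R[i]) x y : closure (range A) x -> closure (range A) y ->
  closure (range A) (a *: x + y).
Proof.
have near_ran z : closure (range A) z <->
    forall e : R[i], 0 < e -> exists u, `|z - A u| < e.
  split=> [cz e e0|cz B /nbhs_normP[/= e e0 eB]].
    have [_ [[u _ <-]]] := cz _ (nbhsx_ballx z e e0).
    by rewrite -ball_normE => zu; exists u.
  have [u zu] := cz e e0; exists (A u); split; first by exists u.
  exact: eB.
move=> /near_ran cx /near_ran cy; apply/near_ran => e e0.
pose c := `|a| + 1; have c0 : 0 < c by rewrite ltr_wpDl.
have [u xu] := cx (e / 2 / c) (divr_gt0 (divr_gt0 e0 (ltr0n _ 2)) c0).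
have [v yv] := cy (e / 2) (divr_gt0 e0 (ltr0n _ 2)).
exists (a *: u + v); rewrite linearP opprD addrACA -scalerBr.
rewrite (le_lt_trans (ler_normD _ _))// [ltRHS](splitr e) ler_ltD// normrZ.
rewrite (@le_trans _ _ (c * `|x - A u|))// ?ler_wpM2r// ?lerDl//.
by rewrite mulrC -ler_pdivlMr// ltW.
Qed.

Definition ran_closure : closed_subspace K :=
  ClosedSubspace ran0 ranP (@closed_closure _ (range A)).

Let ranA x : A x \in subspace_pred ran_closure.
Proof. by rewrite inE; apply: subset_closure; exists x. Qed.

(* A with its codomain restricted to the closure of its range *)
Definition ran_op (x : H) : subspace_type ran_closure := SubspaceElt (ranA x).

End RangeClosure.

Section RowOp.
Variables (R : realType) (d : nat) (H : hilbertType R) (T : 'I_d -> 'B(H, H)).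

Definition row_op (x : hpow d H) : H := \sum_(i < d) T i (x i).

Let row_op_linear : linear row_op.
Proof.
move=> a x y; rewrite /row_op scaler_sumr -big_split; apply: eq_bigr => i _.
by rewrite !ffunE linearP.
Qed.

Let row_op_bounded : exists M : R[i], forall x, `|row_op x| <= M * `|x|.
Proof.
have /choice[M MT] : forall i, exists M : R[i], 0 <= M /\
    forall x, `|T i x| <= M * `|x|.
  move=> i; have [M MT] := @bounded_op _ _ _ (T i); exists `|M|; split => // x.
  have := MT x; rewrite -[leLHS]ger0_norm// => MTx.
  rewrite -[leLHS]ger0_norm// (le_trans _ (_ : `|M * `|x| | <= _)) //.
    by rewrite ger0_norm ?(ger0_norm (le_trans _ MTx))// normr_ge0.
  by rewrite normrM normr_id.
exists (\sum_(i < d) M i) => x; rewrite /row_op mulr_suml.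
rewrite (le_trans (ler_norm_sum _ _ _))// ler_sum// => i _.
have [M0 MTi] := MT i; rewrite (le_trans (MTi _))// ler_wpM2l//.
rewrite -ler_sqr ?nnegrE// -!dotpxx.
rewrite [leRHS](bigD1 i)//= lerDl sumr_ge0// => j _; exact: dnorm_ge0.
Qed.

HB.instance Definition _ :=
  GRing.isLinear.Build R[i] (hpow d H) H *:%R row_op row_op_linear.
HB.instance Definition _ := isBoundedOp.Build R (hpow d H) H row_op row_op_bounded.

End RowOp.

Definition row_contraction (R : realType) (d : nat) (H : hilbertType R)
    (T : 'I_d -> 'B(H, H)) :=
  op_le (fun x => \sum_(i < d) T i (adjoint (T i) x)) id.

Definition defect_op (R : realType) (H K : hilbertType R) (A : 'B(H, K)) : 'B(H, H) :=
  op_sqrt (fun x => x - adjoint A (A x)).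

Definition defect_op_star (R : realType) (H K : hilbertType R) (A : 'B(H, K)) :
    'B(K, K) :=
  op_sqrt (fun y => y - A (adjoint A y)).

Definition defect_space (R : realType) (H K : hilbertType R) (A : 'B(H, K)) :
  hilbertType R := subspace_type (ran_closure (defect_op A)).

Definition defect_space_star (R : realType) (H K : hilbertType R) (A : 'B(H, K)) :
  hilbertType R := subspace_type (ran_closure (defect_op_star A)).

(* Vector.axiom n H is the type of linear bijections from H to C^n. *)
Definition has_dim (R : realType) (n : nat) (H : hilbertType R) : Prop :=
  inhabited (Vector.axiom n H).

(* The operator with block matrix [A B; C D]. *)
Definition block_op (R : realType) (H1 H2 K1 K2 : hilbertType R)
    (A : H1 -> K1) (B : H2 -> K1) (C : H1 -> K2) (D : H2 -> K2)
    (x : dsum H1 H2) : dsum K1 K2 :=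
  (A x.1 + B x.2, C x.1 + D x.2).

(* A colligation with state space H1, input space H2 and output space H3. *)
Section Colligation.
Variables (R : realType) (d : nat) (H1 H2 H3 : hilbertType R).
Variable W : dsum H1 H2 -> dsum (hpow d H1) H3.

Definition basic_op (i : 'I_d) (x : H1) : H1 := (W (x, 0)).1 i.

Definition output_op (x : H1) : H3 := (W (x, 0)).2.

(* A vector of the tensor product of the full Fock space with H3 is represented
   by the family of its H3-coefficients along the basis (e_alpha), indexed by the
   words alpha; for alpha = (a_1, ..., a_n) the fold applies X_{a_1} first. *)
Definition observability_op (x : H1) (alpha : seq 'I_d) : H3 :=
  output_op (foldl (fun y i => basic_op i y) x alpha).

Definition observable := injective observability_op.

End Colligation.

(* Main.v *)
(** Put [D = D_T] and write [S] for the row [T]. Co-isometry of [W] gives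
    [F F^* = I - S^* S = D^2], so that [|F^* v| = |D v|] for all [v]. Both [F^*] and [D]
    are injective on the finite-dimensional defect space, hence by equality of
    dimensions [sigma (F^* v) := D v] defines a unitary from [U] onto the defect space,
    and [F = D sigma]. Since [S D = D_* S], the matrix [S^*, D sigma; D_*, - S sigma] is
    unitary, and multiplying [W] by its adjoint leaves [diag(I, gamma)] with
    [gamma = G D_* - E sigma^* S^*]. *)

Require Import Defs.
From HB Require Import structures.
From mathcomp Require Import all_boot all_order all_algebra.
From mathcomp Require Import all_classical all_reals all_analysis.
From mathcomp Require Import complex.
From mathcomp Require Import ring.

Set Implicit Arguments.
Unset Strict Implicit.

Import Order.TTheory GRing.Theory Num.Theory.
Import numFieldNormedType.Exports.

Local Open Scope classical_set_scope.
Local Open Scope ring_scope.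

Local Notation "''[' u , v ]" := (dotp u v) : ring_scope.

(** [adjoint] and [op_sqrt] are picked by [xget], so they can be used only after existence is
    proved, and for the root uniqueness as well. The relation [S D = D_* S] asks for more than the
    defining equation of a root: it holds because both roots are limits of the same polynomials,
    taken in [S^* S] and in [S S^*]. These operators may have norm 1, so a geometric rate cannot be
    expected; the rate [1 / n] is what survives, and all limits are set up for it. Finite dimension
    is used twice: it makes [F^*] map the defect space onto [U], so that [sigma] is defined
    everywhere, and it makes [D] map the defect space onto itself, so that [sigma] is surjective.
    Since [gamma] lives on the closure of the range of [D_*], both [S] and [S^*] are restricted to
    the closed defect spaces before it is formed. *)

(** * Inner products, and limits in the partially ordered field [R[i]] *)

Section InnerProduct.
Context {R : realType} {H : hilbertType R}.
Implicit Types x y z : H.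

Lemma dotpC x y : '[x, y] = ('[y, x])^*.
Proof. by rewrite (hermC dotp) mul1r. Qed.

Lemma dotp_ext x y : (forall z, '[z, x] = '[z, y]) -> x = y.
Proof.
move=> xy; apply/eqP; rewrite -subr_eq0 -(dnorm_eq0 dotp) /=.
by rewrite linearBr /= xy subrr.
Qed.

Lemma cauchy_schwarz x y : `|'[x, y]| <= `|x| * `|y|.
Proof.
rewrite -ler_sqr ?nnegrE ?mulr_ge0// exprMn -!dotpxx.
exact: dot_cauchy_schwarz.
Qed.

(** A positive element of [R[i]] is real, so the Archimedean property of [R] applies to its real
    part. *)
Lemma archi_complex (e : R[i]) : 0 < e -> exists n : nat, n.+1%:R^-1 < e.
Proof.
move=> e0; have eR : e = (complex.Re e)%:C%C by rewrite (RRe_real (gtr0_real e0)).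
have e0' : 0 < complex.Re e by rewrite -ltcR -eR.
have [n _ nP] := near_infty_natSinv_lt (PosNum e0').
exists n; rewrite eR.
have := nP n (leqnn n); rewrite /= -ltcR.
by rewrite fmorphV /= rmorph_nat.
Qed.

Lemma squeeze_le (a b c : R[i]) : a \is Num.real -> b \is Num.real -> 0 <= c ->
  (forall n : nat, a <= b + c / n.+1%:R) -> a <= b.
Proof.
move=> ar br c0 ab; have [//|ba] := real_leP ar br.
(* Dividing by [c + 1] rather than [c] also covers [c = 0]. *)
have c1 : 0 < c + 1 by rewrite ltr_wpDl.
have d0 : 0 < (a - b) / (c + 1) by rewrite divr_gt0 ?subr_gt0.
have [n] := archi_complex d0.
rewrite ltr_pdivlMr// => nlt.
suff /lt_geF : b + c / n.+1%:R < a by rewrite ab.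
rewrite -ltrBrDl; apply: le_lt_trans nlt; rewrite mulrC ler_wpM2l// ?invr_ge0//.
by rewrite lerDl.
Qed.

Lemma squeeze0 x (c : R[i]) : 0 <= c ->
  (forall n : nat, `|x| <= c / n.+1%:R) -> x = 0.
Proof.
move=> c0 xc; apply/eqP; rewrite -normr_le0.
by apply: (@squeeze_le _ _ c) => // n; rewrite add0r.
Qed.

(** The limit inherits the constant [c]: compare with a late term of [u] and let the remaining error
    [1 / (k + 1)] vanish. Completeness of [H] enters here. *)
Lemma cauchy_rate (u : nat -> H) (c : R[i]) : 0 <= c ->
  (forall m n, (n <= m)%N -> `|u m - u n| <= c / n.+1%:R) ->
  exists l, forall n, `|l - u n| <= c / n.+1%:R.
Proof.
move=> c0 uc.
have cv : cvg (u n @[n --> \oo]).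
  apply: cauchy_cvg; apply/cauchyP => e e0.
  have c1 : 0 < c + 1 by rewrite ltr_wpDl.
  have d0 : 0 < e / (c + 1) by rewrite divr_gt0.
  have [N] := archi_complex d0; rewrite ltr_pdivlMr// => Nlt.
  exists (u N); rewrite /fmap/=; exists N => // m /= Nm.
  rewrite -ball_normE /= distrC (le_lt_trans (uc _ _ Nm))//.
    by apply: le_lt_trans Nlt; rewrite mulrC ler_wpM2l// ?invr_ge0// lerDl.
have /cvg_ex[/= l ul] := cv; exists l => n.
apply: (@squeeze_le _ _ 1) => //.
  by rewrite realM// ger0_real// invr_ge0.
move=> k; rewrite mul1r; have k0 : (0 : R[i]) < k.+1%:R^-1 by rewrite invr_gt0.
have /fcvgrPdist_lt/(_ _ k0) [N _ NP] := ul.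
have := NP (maxn N n) (leq_maxl _ _) => /= lN.
have := uc (maxn N n) n (leq_maxr _ _) => uN.
rewrite -(subrK (u (maxn N n)) l) -addrA (le_trans (ler_normD _ _))//.
by rewrite [leLHS]addrC lerD// ltW.
Qed.

End InnerProduct.

(** * Bounded operators and the Riesz representation *)

(** On the zero space the constant of [bounded_op] may be negative or not real; its modulus always
    serves. *)
Lemma bounded_op_ge0 {R : realType} {H K : hilbertType R} (A : 'B(H, K)) :
  exists2 M : R[i], 0 <= M & forall x, `|A x| <= M * `|x|.
Proof.
have [M AM] := @bounded_op _ _ _ A; exists `|M| => // x.
rewrite -[X in _ * X]normr_id -normrM.
by rewrite ger0_norm// (le_trans _ (AM x)).
Qed.

(** Bundles functions that are obtained by pointwise choice. *)
Lemma bounded_opE {R : realType} {H K : hilbertType R} (f : H -> K) :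
  linear f -> (exists M : R[i], forall x, `|f x| <= M * `|x|) ->
  exists B : 'B(H, K), B =1 f.
Proof.
move=> fl fb.
pose m1 := GRing.isLinear.Build R[i] H K *:%R f fl.
pose m2 := isBoundedOp.Build R H K f fb.
pose B : 'B(H, K) := HB.pack f m1 m2.
by exists B.
Qed.

Section Riesz.
Context {R : realType} {H : hilbertType R}.
Implicit Types x y z w : H.

Lemma norm_sqrD x w :
  `|x + w| ^+ 2 = `|x| ^+ 2 + `|w| ^+ 2 + 'Re '[w, x] *+ 2.
Proof.
rewrite -!dotpxx linearDl/= !linearDr/= (dotpC x w) ReE -mulr_natr.
by field.
Qed.

Lemma parallelogram x y :
  `|x + y| ^+ 2 + `|x - y| ^+ 2 = (`|x| ^+ 2 + `|y| ^+ 2) *+ 2.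
Proof.
rewrite -!dotpxx !linearDl/= !linearDr/= !linearNl/= !linearNr/= mulr2n; ring.
Qed.

(* The representing vector minimises |x|^2 - 2 Re (phi x). *)
Lemma riesz (phi : {linear H -> R[i] | *%R}) (M : R[i]) : 0 <= M ->
  (forall x, `|phi x| <= M * `|x|) -> exists y, forall x, phi x = '[x, y].
Proof.
move=> M0 phiM.
(* An infimum is available in [R] but not in [R[i]], hence the real part; [JE] shows that nothing is
   lost by it. *)
pose J x : R := complex.Re (`|x| ^+ 2 - 'Re (phi x) *+ 2).
have JE x : (J x)%:C%C = `|x| ^+ 2 - 'Re (phi x) *+ 2.
  by rewrite /J RRe_real// rpredB ?rpredX ?rpredMn ?Creal_Re// ger0_real.
have JD x w : (J (x + w))%:C%C =
    (J x)%:C%C + `|w| ^+ 2 + ('Re ('[w, x] - phi w)) *+ 2.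
  by rewrite !JE linearD !raddfD /= raddfN /= norm_sqrD; ring.
have Jpar x y : `|x - y| ^+ 2 =
    ((J x)%:C%C + (J y)%:C%C) *+ 2 - (J (2^-1 *: (x + y)))%:C%C *+ 4.
    have pxy : 'Re (phi (2^-1 *: (x + y))) = ('Re (phi x) + 'Re (phi y)) / 2.
      rewrite linearZ/= linearD !ReE !rmorphM/= rmorphD/= fmorphV/= rmorph_nat.
      by field.
    have := parallelogram x y; rewrite !JE pxy normrZ exprMn normfV normr_nat => pl.
    have -> : `|x - y| ^+ 2 = (`|x| ^+ 2 + `|y| ^+ 2) *+ 2 - `|x + y| ^+ 2.
      by rewrite -pl; ring.
    by field.
have Jlb x : complex.Re (- M ^+ 2) <= J x.
  rewrite -lecR JE RRe_real ?realN ?realX ?ger0_real//.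
  have : 'Re (phi x) <= M * `|x|.
    exact: le_trans (leif_Re_Creal _) (phiM x).
  have : 0 <= (`|x| - M) ^+ 2.
    by rewrite real_exprn_even_ge0// realB// ger0_real.
  rewrite sqrrB => h1 h2; rewrite -subr_ge0.
  apply: le_trans h1 _.
  have -> : `|x| ^+ 2 - 'Re (phi x) *+ 2 - - M ^+ 2 =
    `|x| ^+ 2 - `|x| * M *+ 2 + M ^+ 2 + (M * `|x| - 'Re (phi x)) *+ 2 by ring.
  by rewrite lerDl mulrn_wge0// subr_ge0.
have Jinf : has_inf (range J).
  by split; [exists (J 0), 0|exists (complex.Re (- M ^+ 2)) => _ [x _ <-]].
have Jge x : inf (range J) <= J x by apply: ge_inf; [case: Jinf|exists x].
(* The precision is squared because [Jpar] bounds the squared distance of two terms by their excess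
   over the infimum; the terms then converge at the rate [2 / (n + 1)]. *)
have /choice[u uP] : forall n : nat, exists x, J x <= inf (range J) + n.+1%:R^-1 ^+ 2.
  move=> n; have e0 : (0 : R) < n.+1%:R^-1 ^+ 2 by rewrite exprn_gt0// invr_gt0.
  by have [_ [x _ <-] /ltW] := inf_adherent e0 Jinf; exists x.
have uPC n : (J (u n))%:C%C <= (inf (range J))%:C%C + n.+1%:R^-1 ^+ 2.
  have := uP n; rewrite -lecR rmorphD/= rmorphXn/= fmorphV/= rmorph_nat; exact.
have JgeC x : (inf (range J))%:C%C <= (J x)%:C%C by rewrite lecR.
have [l lP] : exists l, forall n, `|l - u n| <= 2 / n.+1%:R.
  apply: cauchy_rate => // m n nm.
  rewrite -ler_sqr ?nnegrE ?divr_ge0// Jpar.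
  have := JgeC (2^-1 *: (u m + u n)); have := uPC m; have := uPC n => h1 h2 h3.
  have mn : m.+1%:R^-1 ^+ 2 <= n.+1%:R^-1 ^+ 2 :> R[i].
    by rewrite ler_sqr ?nnegrE ?invr_ge0// lef_pV2 ?posrE// ler_nat.
  have -> : (2 / n.+1%:R) ^+ 2 = ((inf (range J))%:C%C + n.+1%:R^-1 ^+ 2 +
      ((inf (range J))%:C%C + n.+1%:R^-1 ^+ 2)) *+ 2 - (inf (range J))%:C%C *+ 4.
    by rewrite exprMn; ring.
  rewrite lerB ?lerMn2r//= lerD//.
  by rewrite (le_trans h2)// lerD2l.
(* Minimality of [l] in expanded form. By [JD] the term [J (u n)] cancels up to [1 / (n + 1) ^ 2],
   and only ['[w, u n]] has to pass to the limit. *)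
have lmin w : 0 <= `|w| ^+ 2 + 'Re ('[w, l] - phi w) *+ 2.
  (* The 1 absorbs [1 / (n + 1) ^ 2 <= 1 / (n + 1)]; the 4 is the factor 2 in front of the real part
     times the rate 2 of [lP]. *)
  apply: (@squeeze_le _ _ _ (1 + `|w| *+ 4)).
  - exact: real0.
  - by rewrite rpredD ?rpredX ?rpredMn ?Creal_Re// ger0_real.
  - by rewrite addr_ge0// mulrn_wge0.
  move=> n; have := le_trans (JgeC (u n + w)) (lexx _); rewrite JD.
  have := uPC n => h1 h2.
  have h3 : 0 <= n.+1%:R^-1 ^+ 2 + `|w| ^+ 2 + 'Re ('[w, u n] - phi w) *+ 2.
    have -> : n.+1%:R^-1 ^+ 2 + `|w| ^+ 2 + 'Re ('[w, u n] - phi w) *+ 2 =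
      ((inf (range J))%:C%C + n.+1%:R^-1 ^+ 2 - (J (u n))%:C%C) +
      ((J (u n))%:C%C + `|w| ^+ 2 + 'Re ('[w, u n] - phi w) *+ 2
       - (inf (range J))%:C%C) by ring.
    by rewrite addr_ge0// subr_ge0.
  apply: le_trans h3 _.
  have h4 : 'Re ('[w, u n] - phi w) <= 'Re ('[w, l] - phi w) + `|w| * (2 / n.+1%:R).
    rewrite -lerBlDl -raddfB/= opprB addrA subrK -linearBr/=.
    rewrite (le_trans (leif_Re_Creal _))// (le_trans (cauchy_schwarz _ _))//.
    by rewrite ler_wpM2l// distrC.
  have h5 : n.+1%:R^-1 ^+ 2 <= n.+1%:R^-1 :> R[i].
    by rewrite expr2 ler_piMr ?invr_ge0// invf_le1// ler1n.
  have -> : `|w| ^+ 2 + 'Re ('[w, l] - phi w) *+ 2 + (1 + `|w| *+ 4) / n.+1%:R =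
    n.+1%:R^-1 + `|w| ^+ 2 + ('Re ('[w, l] - phi w) + `|w| * (2 / n.+1%:R)) *+ 2.
    by ring.
  by rewrite lerD ?lerMn2r// lerD2r.
exists l => z; apply/eqP; rewrite eq_sym -subr_eq0; set c := _ - _.
suff c2 : `|c| ^+ 2 *+ 2 <= 0.
  have : `|c| ^+ 2 *+ 2 == 0 by rewrite eq_le c2 mulrn_wge0 ?exprn_ge0.
  by rewrite mulrn_eq0 expf_eq0 normr_eq0.
apply: (@squeeze_le _ _ _ (`|c| ^+ 2 * `|z| ^+ 2)).
- by rewrite rpredMn// rpredX// ger0_real.
- exact: real0.
- by rewrite mulr_ge0// exprn_ge0.
move=> n; rewrite add0r.
(* With [w = - t c^* z] and [t = 1 / (n + 1)], minimality reads
   [0 <= t ^ 2 |c| ^ 2 |z| ^ 2 - 2 t |c| ^ 2]; divided by [t], it squeezes [|c| ^ 2] to 0. *)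
have := lmin (- (n.+1%:R^-1 * c^*) *: z).
have -> : phi (- (n.+1%:R^-1 * c^*) *: z) = - (n.+1%:R^-1 * c^*) * phi z.
  exact: linearZ.
rewrite linearZl_LR/= -mulrBr -/c normrZ normrN normrM norm_conjC.
rewrite mulNr -[n.+1%:R^-1 * c^* * c]mulrA [c^* * _]mulrC -normCK raddfN/=.
rewrite [`|n.+1%:R^-1|]ger0_norm ?invr_ge0//.
have -> : 'Re (n.+1%:R^-1 * `|c| ^+ 2) = n.+1%:R^-1 * `|c| ^+ 2.
  by apply/Creal_ReP; rewrite rpredM ?rpredX ?rpredV ?ger0_real.
have -> : (n.+1%:R^-1 * `|c| * `|z|) ^+ 2 + - (n.+1%:R^-1 * `|c| ^+ 2) *+ 2 =
   (n.+1%:R^-1) * (`|c| ^+ 2 * `|z| ^+ 2 / n.+1%:R - `|c| ^+ 2 *+ 2) by ring.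
by rewrite pmulr_rge0 ?invr_gt0// subr_ge0.
Qed.

End Riesz.

(** * Adjoints *)

Section Adjoint.
Context {R : realType} {H K : hilbertType R}.

(** Riesz for [x |-> '[A x, y]] gives the value at [y]. The bound of [A] carries over, because [|B
    y| ^ 2 = '[A (B y), y]]. *)
Lemma adjoint_exists (A : 'B(H, K)) : exists B : 'B(K, H), is_adjoint A B.
Proof.
have [M M0 AM] := bounded_op_ge0 A.
have /choice[B BP] : forall y, exists z, forall x, '[A x, y] = '[x, z].
  move=> y; pose phi x := '[A x, y].
  have phil : linear_for *%R phi by move=> a x z; rewrite /phi linearP linearPl.
  pose m := GRing.isLinear.Build R[i] H R[i] *%R phi phil.
  pose p : {linear H -> R[i] | *%R} := HB.pack phi m.
  apply: (@riesz _ _ p (M * `|y|)); first by rewrite mulr_ge0.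
  move=> x; rewrite (le_trans (cauchy_schwarz _ _))// mulrAC ler_wpM2r//.
have Bl : linear B.
  move=> a y z; apply: dotp_ext => x.
  by rewrite -BP linearPr/= !BP linearPr.
have [|B' B'B] := bounded_opE Bl; last first.
  by exists B' => x y; rewrite B'B BP.
exists M => y; have [->|By0] := eqVneq (B y) 0; first by rewrite normr0 mulr_ge0.
rewrite -(ler_pM2l (_ : 0 < `|B y|)) ?normr_gt0// -expr2 -dotpxx -BP.
rewrite -[leLHS]ger0_norm ?BP ?dnorm_ge0// -BP.
rewrite (le_trans (cauchy_schwarz _ _))// mulrA ler_wpM2r// mulrC.
exact: AM.
Qed.

Lemma adjointP (A : 'B(H, K)) : is_adjoint A (adjoint A).
Proof. by rewrite /adjoint; case: xgetP => // /(_ _) P; have [B /P] := adjoint_exists A. Qed.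

Lemma adjointPr (A : 'B(H, K)) x y : '[adjoint A x, y] = '[x, A y].
Proof. by rewrite dotpC -adjointP -dotpC. Qed.

Lemma adjoint_eq (A : 'B(H, K)) (B : K -> H) : is_adjoint A B -> adjoint A =1 B.
Proof. by move=> AB y; apply: dotp_ext => x; rewrite -adjointP AB. Qed.

(** Cauchy-Schwarz in [|A x| ^ 2 = '[x, adjoint A (A x)]], then division by [|A x|]. *)
Lemma contractive_adjoint (A : 'B(H, K)) :
  contractive (adjoint A) -> contractive A.
Proof.
move=> cA x; have [->|Ax0] := eqVneq (A x) 0; first by rewrite normr0.
rewrite -(ler_pM2l (_ : 0 < `|A x|)) ?normr_gt0// -expr2 -dotpxx adjointP.
rewrite -[leLHS]ger0_norm -?adjointP ?dnorm_ge0// adjointP mulrC.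
by rewrite (le_trans (cauchy_schwarz _ _))// ler_wpM2l.
Qed.

End Adjoint.

(** * Convergence with a rate *)

Section RateConvergence.
Context {R : realType} {H : hilbertType R}.
Implicit Types u v : nat -> H.

(* Convergence at the rate 1/n: every limit below has this rate, so that no
   filter is needed. *)
Definition rate_cvg u (l : H) :=
  exists2 c : R[i], 0 <= c & forall n, `|l - u n| <= c / n.+1%:R.

Lemma rate_cvg_unique u l m : rate_cvg u l -> rate_cvg u m -> l = m.
Proof.
move=> [c c0 ul] [e e0 um]; apply/eqP; rewrite -subr_eq0; apply/eqP.
apply: (@squeeze0 _ _ _ (c + e)); first exact: addr_ge0.
move=> n; rewrite -(subrK (u n) l) -addrA (le_trans (ler_normD _ _))//.
by rewrite mulrDl lerD// distrC.
Qed.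

Lemma rate_cvgD u v l m :
  rate_cvg u l -> rate_cvg v m -> rate_cvg (fun n => u n + v n) (l + m).
Proof.
move=> [c c0 ul] [e e0 um]; exists (c + e); first exact: addr_ge0.
move=> n; rewrite opprD addrACA (le_trans (ler_normD _ _))// mulrDl.
exact: lerD.
Qed.

Lemma rate_cvg_cst l : rate_cvg (fun=> l) l.
Proof. by exists 0 => // n; rewrite subrr normr0 mul0r. Qed.

Lemma rate_cvgZ (a : R[i]) u l : rate_cvg u l -> rate_cvg (fun n => a *: u n) (a *: l).
Proof.
move=> [c c0 ul]; exists (`|a| * c); first exact: mulr_ge0.
by move=> n; rewrite -scalerBr normrZ -mulrA ler_wpM2l.
Qed.

Lemma rate_cvgS u l : rate_cvg u l -> rate_cvg (fun n => u n.+1) l.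
Proof.
move=> [c c0 ul]; exists c => // n; rewrite (le_trans (ul _))// ler_wpM2l//.
by rewrite lef_pV2 ?posrE// ler_nat.
Qed.

End RateConvergence.

Lemma rate_cvg_op {R : realType} {H K : hilbertType R} (S : 'B(H, K)) u l :
  rate_cvg u l -> rate_cvg (fun n => S (u n)) (S l).
Proof.
have [M M0 SM] := bounded_op_ge0 S.
move=> [c c0 ul]; exists (M * c); first exact: mulr_ge0.
by move=> n; rewrite -linearB (le_trans (SM _))// -mulrA ler_wpM2l.
Qed.

(** * Positive operators and uniqueness of the square root *)

(** Self-adjointness for a bare function, so that it also applies to iterates that are not bundled
    as bounded operators. *)
Definition symmetric_op {R : realType} {H : hilbertType R} (A : H -> H) :=
  forall x y, '[A x, y] = '[x, A y].

Section PositiveOp.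
Context {R : realType} {H : hilbertType R}.

Lemma positive_ge0 (B : H -> H) x : op_le \0 B -> 0 <= '[B x, x].
Proof. by move=> /(_ x); rewrite linear0l. Qed.

(** Polarisation of [s], which vanishes on the diagonal since nonnegative numbers are real. Thus
    [s y x = - s x y], and the same relation for ['i *: x] and [y] turns into
    ['i * s x y *+ 2 = 0]. *)
Lemma positive_symmetric (B : 'B(H, H)) : op_le \0 B -> symmetric_op B.
Proof.
move=> B0; pose s x y := '[B x, y] - '[x, B y].
have sxx x : s x x = 0.
  have /CrealP B0x := ger0_real (positive_ge0 x B0).
  by rewrite /s -{1}B0x -dotpC subrr.
have sD x y : s x y + s y x = 0.
  have : s (x + y) (x + y) = s x x + s y y + (s x y + s y x).
    by rewrite /s !linearD/= !linearDl/=; ring.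
  by rewrite !sxx !add0r => <-.
move=> x y; apply/eqP; rewrite -subr_eq0 -/(s x y); apply/eqP.
have := sD ('i *: x) y.
have -> : s ('i *: x) y = 'i * s x y.
  by rewrite /s linearZ/= !linearZl_LR/= mulrBr.
have -> : s y ('i *: x) = - 'i * s y x.
  have Bi : B ('i *: x) = 'i *: B x by exact: linearZ.
  by rewrite /s Bi !linearZr_LR/= conjCi mulrBr.
have -> : s y x = - s x y by apply/eqP; rewrite -addr_eq0 addrC sD.
rewrite mulrNN -mulr2n => /eqP; rewrite mulrn_eq0/= mulf_eq0 => /orP[|/eqP//].
by rewrite (negPf (neq0Ci _)).
Qed.

(** Positivity at [y - t *: B y] gives [2 |B y| ^ 2 <= t '[B (B y), B y]] for every
    [t = 1 / (n + 1)]. *)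
Lemma positive_kernel (B : 'B(H, H)) y : op_le \0 B -> '[B y, y] = 0 -> B y = 0.
Proof.
move=> B0 By0; have sB := positive_symmetric B0.
have [M M0 BM] := bounded_op_ge0 B.
apply/eqP; rewrite -(dnorm_eq0 dotp) /=; apply/eqP/le_anti.
rewrite dnorm_ge0 andbT.
suff : '[B y, B y] *+ 2 <= 0 by rewrite pmulrn_lle0.
have k0 : 0 <= '[B (B y), B y] by exact: positive_ge0.
apply: (@squeeze_le _ _ _ '[B (B y), B y]) => //.
- by rewrite rpredMn// ger0_real// dnorm_ge0.
move=> n; rewrite add0r.
set t : R[i] := n.+1%:R^-1.
have t0 : 0 < t by rewrite invr_gt0.
have := positive_ge0 (y - t *: B y) B0.
have -> : B (y - t *: B y) = B y - t *: B (B y) by rewrite linearB linearZ.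
rewrite linearBl/= !linearBr/= !linearZl_LR/= !linearZr_LR/=.
have tc : t^* = t by apply/CrealP; rewrite ger0_real// ltW.
rewrite By0 tc /= (sB (B y) y).
have -> : 0 - t * '[B y, B y] - (t * '[B y, B y] - t * (t * '[B (B y), B y])) =
  t * ('[B (B y), B y] * t - '[B y, B y] *+ 2) by ring.
by rewrite pmulr_rge0// subr_ge0.
Qed.

(** Commutation gives [(B + C) (B - C) = B ^ 2 - C ^ 2 = 0]. At [y = B x - C x] the two nonnegative
    forms therefore add up to 0, so [B y = C y = 0], and [|y| ^ 2 = '[x, (B - C) y] = 0]. *)
Lemma positive_sqrt_unique (B C : 'B(H, H)) : op_le \0 B -> op_le \0 C ->
  B \o B =1 C \o C -> B \o C =1 C \o B -> B =1 C.
Proof.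
move=> B0 C0 sqBC comBC x; apply/eqP; rewrite -subr_eq0 -(dnorm_eq0 dotp) /=.
set y := B x - C x.
have BCy : B y + C y = 0.
  rewrite /y !linearB/=; have /= -> := sqBC x; have /= -> := comBC x.
  by rewrite addrC addrA subrK subrr.
have y0 : '[B y, y] + '[C y, y] = 0 by rewrite -linearDl/= BCy linear0l.
have /eqP := y0; rewrite paddr_eq0 ?positive_ge0// => /andP[/eqP By /eqP Cy].
rewrite {1}/y linearBl/= !positive_symmetric// (positive_kernel B0 By).
by rewrite (positive_kernel C0 Cy) subrr.
Qed.

End PositiveOp.

(** * Existence of the square root by iteration *)

Section SquareRoot.
Context {R : realType}.

(* The iterates Y_{n+1} = (C + Y_n^2) / 2 converge to a fixed point L, which satisfies
   (1 - L)^2 = 1 - C. The same recursion on the number 1 yields 1 - sqrt_gap n,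
   which bounds the norm of Y_n. *)
Fixpoint sqrt_iter {H : hilbertType R} (C : 'B(H, H)) n (x : H) : H :=
  if n is n'.+1 then 2^-1 *: (C x + sqrt_iter C n' (sqrt_iter C n' x)) else 0.

Fixpoint sqrt_gap n : R[i] :=
  if n is n'.+1 then sqrt_gap n' - sqrt_gap n' ^+ 2 / 2 else 1.

(** The recursion discretises [g' = - g ^ 2 / 2] with [g 0 = 1], whose solution is [2 / (t + 2)]. *)
Lemma sqrt_gap_bound n : 0 <= sqrt_gap n <= 2 / n.+2%:R.
Proof.
elim: n => [|n /andP[g0 gb]] /=; first by rewrite ler01 divff ?lexx ?pnatr_eq0.
set g := sqrt_gap n in g0 gb *; set b := 2 / n.+2%:R in gb *.
have b1 : b <= 1 by rewrite ler_pdivrMr// mul1r ler_nat.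
have g1 : g <= 1 by exact: le_trans gb b1.
apply/andP; split.
  have -> : g - g ^+ 2 / 2 = g * ((1 - g) + g / 2) by field.
  by rewrite mulr_ge0// addr_ge0 ?divr_ge0// subr_ge0.
rewrite -subr_ge0.
have N3 : n.+3%:R = n.+2%:R + 1 :> R[i] by rewrite -natr1.
(* The first summand expresses that [g - g ^ 2 / 2] increases on [[0, 1]]; the second is the slack
   of the bound [b] itself under the recursion. *)
have -> : 2 / n.+3%:R - (g - g ^+ 2 / 2) =
    (b - g) * ((1 - b) + (1 - g)) / 2 + 2 / (n.+2%:R ^+ 2 * n.+3%:R).
  by rewrite /b N3; field; rewrite !lt0r_neq0 ?ltr_wpDr ?ltr_wpDl.
apply: addr_ge0.
  apply: divr_ge0 => //; apply: mulr_ge0; first by rewrite subr_ge0.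
  by apply: addr_ge0; rewrite subr_ge0.
by apply: divr_ge0 => //; rewrite mulr_ge0// exprn_ge0.
Qed.

Lemma sqrt_gap_le1 n : sqrt_gap n <= 1.
Proof.
have /andP[_ g] := sqrt_gap_bound n; rewrite (le_trans g)//.
by rewrite ler_pdivrMr// mul1r ler_nat.
Qed.

Lemma sqrt_iter_linear {H : hilbertType R} (C : 'B(H, H)) n : linear (sqrt_iter C n).
Proof.
elim: n => [|n IH] a x y /=; first by rewrite scaler0 addr0.
rewrite linearP !IH addrACA -scalerDr [LHS]scalerDr.
by rewrite !scalerA [2^-1 * a]mulrC.
Qed.

HB.instance Definition _ (H : hilbertType R) (C : 'B(H, H)) n :=
  GRing.isLinear.Build R[i] H H *:%R (sqrt_iter C n) (sqrt_iter_linear C n).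

(** The iterates are polynomials in the operator, with coefficients independent of it. [S] is only
    assumed linear so that it can be an iterate itself. *)
Lemma sqrt_iter_intertwine {H K : hilbertType R} (S : {linear H -> K})
    (C : 'B(H, H)) (D : 'B(K, K)) n :
  S \o C =1 D \o S -> S \o sqrt_iter C n =1 sqrt_iter D n \o S.
Proof.
move=> SC; elim: n => [|n IH] x /=; first by rewrite linear0.
rewrite linearZ linearD/=; have /= -> := SC x.
by have /= -> := IH (sqrt_iter C n x); have /= -> := IH x.
Qed.

Lemma sqrt_iter_comm {H : hilbertType R} (C : 'B(H, H)) m n x :
  sqrt_iter C m (sqrt_iter C n x) = sqrt_iter C n (sqrt_iter C m x).
Proof.
apply: (@sqrt_iter_intertwine _ _ (sqrt_iter C m)) => {}x /=.
by have /= -> := @sqrt_iter_intertwine _ _ C C C m (fun=> erefl) x.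
Qed.

Section Contraction.
Context {H : hilbertType R} (C : 'B(H, H)).
Hypothesis C_contr : contractive C.

Lemma sqrt_iter_norm n x : `|sqrt_iter C n x| <= (1 - sqrt_gap n) * `|x|.
Proof.
elim: n x => [|n IH] x /=; first by rewrite subrr mul0r normr0.
rewrite normrZ ger0_norm ?invr_ge0// mulrC ler_pdivrMr//.
rewrite (le_trans (ler_normD _ _))//.
have -> : (1 - (sqrt_gap n - sqrt_gap n ^+ 2 / 2)) * `|x| * 2 =
  `|x| + (1 - sqrt_gap n) * ((1 - sqrt_gap n) * `|x|) by field.
rewrite lerD// (le_trans (IH _))// ler_wpM2l//.
by rewrite subr_ge0 sqrt_gap_le1.
Qed.

Lemma sqrt_iter_contr n : contractive (sqrt_iter C n).
Proof.
move=> x; rewrite (le_trans (sqrt_iter_norm _ _))// ler_piMl//.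
by rewrite lerBlDr lerDl; have /andP[] := sqrt_gap_bound n.
Qed.

(** Since the iterates commute, [Y_{n+2} - Y_{n+1}] is half of [(Y_{n+1} + Y_n) (Y_{n+1} - Y_n)].
    The numbers [1 - sqrt_gap n] factor in the same way and so majorise the steps. *)
Lemma sqrt_iter_step n x :
  `|sqrt_iter C n.+1 x - sqrt_iter C n x| <= (sqrt_gap n - sqrt_gap n.+1) * `|x|.
Proof.
elim: n x => [|n IH] x.
  rewrite /= addr0 subr0 normrZ ger0_norm ?invr_ge0//.
  have -> : 1 - (1 - 1 ^+ 2 / 2) = 2^-1 :> R[i] by field.
  by rewrite ler_wpM2l.
set y := sqrt_iter C n.+1 x - sqrt_iter C n x.
have LB k a b : sqrt_iter C k (a - b) = sqrt_iter C k a - sqrt_iter C k b.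
  exact: linearB.
have -> : sqrt_iter C n.+2 x - sqrt_iter C n.+1 x =
    2^-1 *: (sqrt_iter C n.+1 y + sqrt_iter C n y).
  rewrite /y !LB (sqrt_iter_comm C n n.+1) addrA subrK.
  by rewrite -[LHS]scalerBr opprD addrACA subrr add0r.
have -> : sqrt_gap n.+1 - sqrt_gap n.+2 =
    2^-1 * ((1 - sqrt_gap n.+1) + (1 - sqrt_gap n)) * (sqrt_gap n - sqrt_gap n.+1).
  by rewrite /=; field.
rewrite normrZ ger0_norm ?invr_ge0// -!mulrA ler_wpM2l ?invr_ge0//.
rewrite (le_trans (ler_normD _ _))//.
rewrite (le_trans (lerD (sqrt_iter_norm _ _) (sqrt_iter_norm _ _)))//.
rewrite -mulrDl; apply: ler_wpM2l; last exact: IH.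
by apply: addr_ge0; rewrite subr_ge0 sqrt_gap_le1.
Qed.

(** The steps telescope to at most [sqrt_gap n <= 2 / (n + 2)], relaxed to [2 / (n + 1)] to fit
    [cauchy_rate]. *)
Lemma sqrt_iter_cauchy m n x : (n <= m)%N ->
  `|sqrt_iter C m x - sqrt_iter C n x| <= (`|x| *+ 2) / n.+1%:R.
Proof.
move=> nm; have : `|sqrt_iter C m x - sqrt_iter C n x| <=
    (sqrt_gap n - sqrt_gap m) * `|x|.
  elim: m nm => [|m IH].
    by rewrite leqn0 => /eqP ->; rewrite !subrr normr0 mul0r.
  rewrite leq_eqVlt => /predU1P[->|nm]; first by rewrite !subrr normr0 mul0r.
  rewrite -(subrK (sqrt_iter C m x) (sqrt_iter C m.+1 x)) -addrA.
  rewrite (le_trans (ler_normD _ _))//.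
  rewrite (le_trans (lerD (sqrt_iter_step _ _) (IH nm)))//.
  by rewrite -mulrDl addrC addrA subrK.
move=> /le_trans; apply.
have /andP[gm _] := sqrt_gap_bound m; have /andP[_ gn] := sqrt_gap_bound n.
have -> : `|x| *+ 2 / n.+1%:R = 2 / n.+1%:R * `|x| by ring.
rewrite ler_wpM2r// (le_trans (_ : _ <= sqrt_gap n))//.
  by rewrite lerBlDr lerDl.
by rewrite (le_trans gn)// ler_wpM2l// lef_pV2 ?posrE// ler_nat.
Qed.

Lemma sqrt_iter_sym n : symmetric_op C -> symmetric_op (sqrt_iter C n).
Proof.
move=> sC; elim: n => [|n IH] x y /=; first by rewrite linear0l linear0r.
rewrite linearZl_LR/= linearZr_LR/= linearDl/= linearDr/= sC !IH.
by rewrite fmorphV/= conjC_nat [in RHS]linearDr/= mulrDr.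
Qed.

Lemma sqrt_iter_limit : exists L : 'B(H, H),
  forall x, rate_cvg (fun n => sqrt_iter C n x) (L x).
Proof.
have /choice[L LP] : forall x, exists l, rate_cvg (fun n => sqrt_iter C n x) l.
  move=> x; have [||l lP] := @cauchy_rate _ _ (sqrt_iter C ^~ x) (`|x| *+ 2).
  - by rewrite mulrn_wge0.
  - by move=> m n; exact: sqrt_iter_cauchy.
  by exists l, (`|x| *+ 2) => //; rewrite mulrn_wge0.
have Ll : linear L.
  move=> a x y; apply: rate_cvg_unique (LP _) _.
  have := rate_cvgD (rate_cvgZ a (LP x)) (LP y).
  by under eq_fun do rewrite -linearP.
have [|B BL] := bounded_opE Ll; last by exists B => x; rewrite BL.
exists 1 => x; rewrite mul1r.
have [c c0 Lc] := LP x; apply: (@squeeze_le _ _ _ c); rewrite ?ger0_real//.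
move=> n; rewrite -(subrK (sqrt_iter C n x) (L x)) (le_trans (ler_normD _ _))//.
by rewrite [leLHS]addrC lerD// sqrt_iter_contr.
Qed.

End Contraction.

Section Limit.
Context {H : hilbertType R} (C : 'B(H, H)).
Hypothesis C_contr : contractive C.
Hypothesis C_sym : symmetric_op C.

(** The root is [1 - L]. Its approximation by the iterates is kept in the conclusion: intertwining
    relations between roots are read off from it. *)
Lemma op_sqrt_exists : exists B : 'B(H, H),
  [/\ op_le \0 B, B \o B =1 (fun x => x - C x) &
      forall x, rate_cvg (fun n => x - sqrt_iter C n x) (B x)].
Proof.
have [L LP] := sqrt_iter_limit C_contr.
have Lcontr : contractive L.
  move=> x; have [c c0 Lc] := LP x.
  apply: (@squeeze_le _ _ _ c); rewrite ?ger0_real//.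
  move=> n; rewrite -(subrK (sqrt_iter C n x) (L x)) (le_trans (ler_normD _ _))//.
  by rewrite [leLHS]addrC lerD// sqrt_iter_contr.
have Lsym : symmetric_op L.
  move=> x y; have [c c0 Lc] := LP x; have [e e0 Le] := LP y.
  apply/eqP; rewrite -subr_eq0 -normr_le0.
  apply: (@squeeze_le _ _ _ (c * `|y| + e * `|x|)); rewrite ?ger0_real//.
    by rewrite addr_ge0// mulr_ge0.
  move=> n; rewrite add0r.
  have -> : '[L x, y] - '[x, L y] =
     '[L x - sqrt_iter C n x, y] - '[x, L y - sqrt_iter C n y].
    by rewrite linearBl/= linearBr/= (sqrt_iter_sym n C_sym); ring.
  rewrite (le_trans (ler_normB _ _))// mulrDl lerD//.
    by rewrite (le_trans (cauchy_schwarz _ _))// mulrAC ler_wpM2r.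
  by rewrite (le_trans (cauchy_schwarz _ _))// mulrC mulrAC ler_wpM2r.
have Lfix x : L x = 2^-1 *: (C x + L (L x)).
  apply: rate_cvg_unique (rate_cvgS (LP x)) _ => /=.
  apply/rate_cvgZ/rate_cvgD; first exact: rate_cvg_cst.
  (* Pointwise limits pass through the composition because the iterates are contractive: compare
     [L (L x)] with [Y_n (L x)], then [Y_n (L x)] with [Y_n (Y_n x)]. *)
  have [c c0 Lc] := LP x; have [e e0 Le] := LP (L x).
  exists (c + e); first exact: addr_ge0.
  move=> n; rewrite -(subrK (sqrt_iter C n (L x)) (L (L x))) -addrA -linearB.
  rewrite (le_trans (ler_normD _ _))// [leLHS]addrC mulrDl lerD//.
  exact: le_trans (sqrt_iter_contr _ _ _) (Lc n).
have Bl : linear (fun x => x - L x).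
  by move=> a x y; rewrite linearP opprD addrACA scalerBr.
have [|B BE] := bounded_opE Bl.
  exists 2 => x; rewrite mulr_natl mulr2n (le_trans (ler_normB _ _))//.
  by rewrite lerD2l.
exists B; split.
- move=> x; rewrite linear0l BE linearBl/= subr_ge0 dotpxx.
  have Lr : '[L x, x] \is Num.real by apply/CrealP; rewrite -dotpC Lsym.
  rewrite (le_trans (real_ler_norm Lr))// (le_trans (cauchy_schwarz _ _))//.
  by rewrite expr2 ler_wpM2r.
- move=> x /=; rewrite !BE linearB/=.
  have -> : C x = L x *+ 2 - L (L x).
    by rewrite {1}Lfix -scaler_nat scalerA divff ?pnatr_eq0// scale1r addrK.
  by rewrite mulr2n !opprB opprD -addrA; congr (_ + _); rewrite addrCA.
move=> x; rewrite BE; apply: rate_cvgD; first exact: rate_cvg_cst.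
by have := rate_cvgZ (-1) (LP x); rewrite scaleN1r; under eq_fun do rewrite scaleN1r.
Qed.

End Limit.

End SquareRoot.

(** * The chosen square root and the defect operators *)

Section BoundedOpAlgebra.
Context {R : realType} {H K L : hilbertType R}.

Lemma comp_bounded (A : 'B(K, L)) (B : 'B(H, K)) :
  exists M : R[i], forall x, `|(A \o B) x| <= M * `|x|.
Proof.
have [M M0 AM] := bounded_op_ge0 A; have [N N0 BN] := bounded_op_ge0 B.
by exists (M * N) => x /=; rewrite (le_trans (AM _))// -mulrA ler_wpM2l.
Qed.

HB.instance Definition _ (A : 'B(K, L)) (B : 'B(H, K)) :=
  isBoundedOp.Build R H L (A \o B) (comp_bounded A B).

Lemma sub_bounded (A B : 'B(H, K)) :
  exists M : R[i], forall x, `|(A \- B) x| <= M * `|x|.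
Proof.
have [M M0 AM] := bounded_op_ge0 A; have [N N0 BN] := bounded_op_ge0 B.
exists (M + N) => x /=; rewrite (le_trans (ler_normB _ _))// mulrDl.
exact: lerD.
Qed.

HB.instance Definition _ (A B : 'B(H, K)) :=
  isBoundedOp.Build R H K (A \- B) (sub_bounded A B).

End BoundedOpAlgebra.

Lemma eq_rate_cvg {R : realType} {H : hilbertType R} (u v : nat -> H) l :
  u =1 v -> rate_cvg u l -> rate_cvg v l.
Proof. by move=> /funext ->. Qed.

Section OpSqrt.
Context {R : realType}.

(** The root [Q] picked by [xget] commutes with [C = 1 - Q ^ 2], hence with the iterates and with
    their limit [B]; uniqueness among commuting positive roots then identifies [Q] with [B]. *)
Lemma op_sqrt_spec {H : hilbertType R} (C : 'B(H, H)) :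
  contractive C -> symmetric_op C ->
  let B := op_sqrt (fun x => x - C x) in
  [/\ op_le \0 B, B \o B =1 (fun x => x - C x) &
      forall x, rate_cvg (fun n => x - sqrt_iter C n x) (B x)].
Proof.
move=> cC sC /=; have [B [B0 BB Blim]] := op_sqrt_exists cC sC.
rewrite /op_sqrt; case: xgetP => [Q _ [Q0 QQ]|/(_ B)]; last by case.
suff QB : Q =1 B by split=> // x; rewrite QB.
apply: positive_sqrt_unique => // x; first by rewrite QQ BB.
have QC z : Q (C z) = C (Q z).
  have CE w : C w = w - Q (Q w) by have /= -> := QQ w; rewrite opprB addrC subrK.
  by rewrite !CE linearB.
apply: (@rate_cvg_unique _ _ (fun n => Q x - sqrt_iter C n (Q x))); last exact: Blim.
apply: eq_rate_cvg (rate_cvg_op Q (Blim x)) => n; rewrite linearB/=; congr (_ - _).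
exact: (@sqrt_iter_intertwine _ _ _ Q).
Qed.

(** [S] carries the approximants of one root to those of the other. For [C = S^* S] and [D = S S^*]
    the hypothesis is associativity, and the conclusion is the exchange rule of the two defect
    operators. *)
Lemma op_sqrt_intertwine {H K : hilbertType R} (S : 'B(H, K))
    (C : 'B(H, H)) (D : 'B(K, K)) x :
  contractive C -> symmetric_op C -> contractive D -> symmetric_op D ->
  S \o C =1 D \o S ->
  S (op_sqrt (fun x => x - C x) x) = op_sqrt (fun y => y - D y) (S x).
Proof.
move=> cC sC cD sD SC.
have [_ _ Clim] := op_sqrt_spec cC sC; have [_ _ Dlim] := op_sqrt_spec cD sD.
apply: rate_cvg_unique (Dlim (S x)).
apply: eq_rate_cvg (rate_cvg_op S (Clim x)) => n; rewrite linearB/=; congr (_ - _).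
exact: (@sqrt_iter_intertwine _ _ _ S).
Qed.

End OpSqrt.

Section Defect.
Context {R : realType} {H K : hilbertType R} (A : 'B(H, K)).
Hypothesis A_contr : contractive (adjoint A).

Let C : 'B(H, H) := adjoint A \o A.
Let D : 'B(K, K) := A \o adjoint A.

Let C_contr : contractive C.
Proof. by move=> x; rewrite (le_trans (A_contr _))//; exact: contractive_adjoint. Qed.

Let D_contr : contractive D.
Proof. by move=> x; rewrite (le_trans _ (A_contr _))//; exact: contractive_adjoint. Qed.

Let C_sym : symmetric_op C.
Proof. by move=> x y; rewrite /= adjointPr adjointP. Qed.

Let D_sym : symmetric_op D.
Proof. by move=> x y; rewrite /= adjointP adjointPr. Qed.

Lemma defect_op_sym : symmetric_op (defect_op A).
Proof. by have [/positive_symmetric] := op_sqrt_spec C_contr C_sym. Qed.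

Lemma defect_op_star_sym : symmetric_op (defect_op_star A).
Proof. by have [/positive_symmetric] := op_sqrt_spec D_contr D_sym. Qed.

Lemma defect_op_sqr x : defect_op A (defect_op A x) = x - adjoint A (A x).
Proof. by have [_ + _] := op_sqrt_spec C_contr C_sym; apply. Qed.

Lemma defect_op_star_sqr y :
  defect_op_star A (defect_op_star A y) = y - A (adjoint A y).
Proof. by have [_ + _] := op_sqrt_spec D_contr D_sym; apply. Qed.

Lemma defect_op_intertwine x : A (defect_op A x) = defect_op_star A (A x).
Proof. exact: (op_sqrt_intertwine _ C_contr C_sym D_contr D_sym). Qed.

Lemma defect_op_star_intertwine y :
  adjoint A (defect_op_star A y) = defect_op A (adjoint A y).
Proof. exact: (op_sqrt_intertwine _ D_contr D_sym C_contr C_sym). Qed.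

End Defect.

(** * Closures of ranges, and dimension *)

Section ClosureRange.
Context {R : realType}.

Lemma closure_rangeP {H K : hilbertType R} (A : 'B(H, K)) z :
  closure (range A) z <-> forall e : R[i], 0 < e -> exists u, `|z - A u| < e.
Proof.
split=> [cz e e0|cz B /nbhs_normP[/= e e0 eB]].
  have [_ [[u _ <-]]] := cz _ (nbhsx_ballx z e e0).
  by rewrite -ball_normE => zu; exists u.
by have [u zu] := cz e e0; exists (A u); split; [exists u|exact: eB].
Qed.

(** The kernel of a symmetric operator is orthogonal to its range: [|z| ^ 2 = '[z, z - A u]] for
    every [u], and [A u] may be taken close to [z]. *)
Lemma closure_range_kernel {H : hilbertType R} (A : 'B(H, H)) z :
  symmetric_op A -> closure (range A) z -> A z = 0 -> z = 0.
Proof.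
move=> sA /closure_rangeP cz Az; apply: (@squeeze0 _ _ _ 1) => // n.
have n0 : (0 : R[i]) < n.+1%:R^-1 by rewrite invr_gt0.
have [u zu] := cz _ n0.
have [->|z0] := eqVneq z 0; first by rewrite normr0 mul1r invr_ge0.
rewrite mul1r -(ler_pM2l (_ : 0 < `|z|)) ?normr_gt0// -expr2 -dotpxx.
have -> : '[z, z] = '[z, z - A u] by rewrite linearBr/= -sA Az linear0l subr0.
rewrite -[leLHS]ger0_norm; last by rewrite linearBr/= -sA Az linear0l subr0 dnorm_ge0.
by rewrite (le_trans (cauchy_schwarz _ _))// ler_wpM2l// ltW.
Qed.

Lemma subspace_dotE {H : hilbertType R} (S : closed_subspace H)
  (v w : subspace_type S) : '[v, w] = '[subspace_val v, subspace_val w].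
Proof. by []. Qed.

Lemma subspace_normE {H : hilbertType R} (S : closed_subspace H)
  (v : subspace_type S) : `|v| = `|subspace_val v|.
Proof.
by apply/eqP; rewrite -(@eqrXn2 _ 2)// -!dotpxx.
Qed.

(** Continuity extends an inclusion of ranges to their closures. This restricts [S] and [S^*] to the
    defect spaces. *)
Lemma ran_closure_map {H H' K K' : hilbertType R} (S : 'B(K, K'))
    (A : 'B(H, K)) (B : 'B(H', K')) : (forall x, exists y, S (A x) = B y) ->
  exists S' : 'B(subspace_type (ran_closure A), subspace_type (ran_closure B)),
    forall v, subspace_val (S' v) = S (subspace_val v).
Proof.
move=> SAB; have [M M0 SM] := bounded_op_ge0 S.
have M1 : 0 < M + 1 by rewrite ltr_wpDl.
have mem v : v \in subspace_pred (ran_closure A) ->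
    S v \in subspace_pred (ran_closure B).
  rewrite !inE => /closure_rangeP cv; apply/closure_rangeP => e e0.
  have [u vu] := cv (e / (M + 1)) (divr_gt0 e0 M1); have [y SAy] := SAB u.
  exists y; rewrite -SAy -linearB (le_lt_trans (SM _))//.
  rewrite ltr_pdivlMr// in vu.
  by apply: le_lt_trans vu; rewrite mulrC ler_wpM2l// lerDl.
pose f (v : subspace_type (ran_closure A)) : subspace_type (ran_closure B) :=
  SubspaceElt (mem _ (subspace_valP v)).
have fl : linear f by move=> a x y; apply/val_inj => /=; exact: linearP.
have [|S' S'E] := bounded_opE fl; last by exists S' => v; rewrite S'E.
by exists M => v; rewrite !subspace_normE; exact: SM.
Qed.

End ClosureRange.

Section Dimension.
Context {F : fieldType} {n : nat} {V W : lmodType F}.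

(** In coordinates [f] becomes a square matrix with trivial kernel, hence an invertible one. *)
Lemma injective_surjective_dim (f : {linear V -> W}) :
  Vector.axiom n V -> Vector.axiom n W -> injective f ->
  forall w, exists v, f v = w.
Proof.
move=> [p pl pb] [q ql qb] fi w.
case: (pb) => p' pK p'K; case: (qb) => q' qK q'K.
have p'l : linear p'.
  by move=> a x y; apply: (can_inj pK); rewrite p'K pl !p'K.
pose h x := q (f (p' x)).
have hl : linear h by move=> a x y; rewrite /h p'l linearP ql.
pose m := GRing.isLinear.Build F 'rV[F]_n 'rV[F]_n *:%R h hl.
pose h' : {linear 'rV[F]_n -> 'rV[F]_n} := HB.pack h m.
have hu : lin1_mx h' \in unitmx.
  rewrite -row_free_unit -kermx_eq0; apply/eqP/row_matrixP => i; rewrite row0.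
  have h0 : h' (row i (kermx (lin1_mx h'))) = h' 0.
    by rewrite -!mul_rV_lin1 mul0mx -row_mul mulmx_ker row0.
  by apply: (can_inj p'K); apply: fi; apply: (can_inj qK).
exists (p' (q w *m invmx (lin1_mx h'))); apply: (can_inj qK).
by have := mul_rV_lin1 h' (q w *m invmx (lin1_mx h')); rewrite mulmxKV.
Qed.

End Dimension.

(** * Rows, isometries and unitaries *)

Lemma adjoint_row_op {R : realType} {d : nat} {H : hilbertType R}
    (T : 'I_d -> 'B(H, H)) y :
  adjoint (row_op T) y = [ffun i => adjoint (T i) y] :> hpow d H.
Proof.
apply: (adjoint_eq (B := fun y => [ffun i => adjoint (T i) y] : hpow d H)) => {}y x.
rewrite /= /row_op linear_sumlz/=; apply: eq_bigr => i _.
by rewrite ffunE adjointP.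
Qed.

(** The form of [\sum_i T_i T_i^*] at [x] is the squared norm of the column of the [T_i^* x]. *)
Lemma row_contraction_adjoint {R : realType} {d : nat} {H : hilbertType R}
    (T : 'I_d -> 'B(H, H)) :
  row_contraction T -> contractive (adjoint (row_op T)).
Proof.
move=> cT x; rewrite -ler_sqr ?nnegrE// -!dotpxx -adjointP adjoint_row_op.
have := cT x; congr (_ <= _); congr '[_, _].
by apply: eq_bigr => i _; rewrite ffunE.
Qed.

Lemma adjointK {R : realType} {H K : hilbertType R} (A : 'B(H, K)) :
  adjoint (adjoint A) =1 A.
Proof. by apply: adjoint_eq => x y; rewrite adjointPr. Qed.

Lemma coisometric_contractive {R : realType} {H K : hilbertType R} (A : 'B(H, K)) :
  coisometric A -> contractive A.
Proof.
move=> AA; apply: contractive_adjoint => y.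
rewrite -ler_sqr ?nnegrE// -!dotpxx adjointPr.
by have /= -> := AA y.
Qed.

Lemma isometry_surjective_unitary {R : realType} {H K : hilbertType R} (A : 'B(H, K)) :
  (forall x y, '[A x, A y] = '[x, y]) -> (forall z, exists x, A x = z) ->
  unitary_op A.
Proof.
move=> isoA surA; have AA x : adjoint A (A x) = x.
  by apply: dotp_ext => z; rewrite -adjointP.
by split=> // z /=; have [x <-] := surA z; rewrite AA.
Qed.

(** * Colligations and the factorisation *)

Section Colligation.
Context {R : realType} {H1 H2 K1 K2 : hilbertType R}.
Variables (A : 'B(H1, K1)) (B : 'B(H2, K1)) (C : 'B(H1, K2)) (D : 'B(H2, K2)).
Variable W : 'B(dsum H1 H2, dsum K1 K2).
Hypothesis WE : W =1 block_op A B C D.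

Lemma adjoint_block_op : adjoint W =1
  block_op (adjoint A) (adjoint C) (adjoint B) (adjoint D).
Proof.
apply: adjoint_eq => -[x1 x2] [y1 y2]; rewrite WE.
have dE (K L : hilbertType R) (x y : dsum K L) : '[x, y] = '[x.1, y.1] + '[x.2, y.2].
  by [].
rewrite !dE /= !linearDl/= !linearDr/= !adjointP.
by rewrite addrACA.
Qed.

Lemma coisometric_block_op : coisometric W ->
  [/\ forall x, A (adjoint A x) + B (adjoint B x) = x,
      forall y, A (adjoint C y) + B (adjoint D y) = 0,
      forall x, C (adjoint A x) + D (adjoint B x) = 0 &
      forall y, C (adjoint C y) + D (adjoint D y) = y].
Proof.
move=> cW; have WW x y := cW (x, y).
split=> [x|y|x|y].
- by have /= := WW x 0; rewrite adjoint_block_op WE /block_op/= !linear0 !addr0 => -[].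
- by have /= := WW 0 y; rewrite adjoint_block_op WE /block_op/= !linear0 !add0r => -[].
- by have /= := WW x 0; rewrite adjoint_block_op WE /block_op/= !linear0 !addr0 => -[].
- by have /= := WW 0 y; rewrite adjoint_block_op WE /block_op/= !linear0 !add0r => -[].
Qed.

End Colligation.

(* [sigma] sends [adjoint F v] to [defect_op S v], for [v] in the defect space. *)
Lemma defect_polar {R : realType} {H K U : hilbertType R} (S : 'B(H, K))
    (F : 'B(U, H)) (n : nat) :
  contractive (adjoint S) ->
  (forall x, adjoint S (S x) + F (adjoint F x) = x) ->
  has_dim n (defect_space S) -> has_dim n U ->
  exists2 sigma : 'B(U, defect_space S), unitary_op sigma &
    forall u, F u = defect_op S (subspace_val (sigma u)).
Proof.
move=> cS SF [dD] [dU].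
have DD x : defect_op S (defect_op S x) = F (adjoint F x).
  by rewrite defect_op_sqr// -{1}(SF x) addrAC subrr add0r.
have Dsym := defect_op_sym cS.
have Dker v : v \in subspace_pred (ran_closure (defect_op S)) ->
    defect_op S v = 0 -> v = 0.
  by rewrite inE; exact: closure_range_kernel.
pose D := ran_op (defect_op S).
pose Dv (v : defect_space S) : defect_space S := D (subspace_val v).
have Dvl : linear Dv by move=> a x y; apply/val_inj => /=; exact: linearP.
pose Dvm := GRing.isLinear.Build R[i] (defect_space S) (defect_space S) *:%R Dv Dvl.
pose Dv' : {linear defect_space S -> defect_space S} := HB.pack Dv Dvm.
pose Fv (v : defect_space S) : U := adjoint F (subspace_val v).
have Fvl : linear Fv by move=> a x y; exact: linearP.
pose Fvm := GRing.isLinear.Build R[i] (defect_space S) U *:%R Fv Fvl.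
pose Fv' : {linear defect_space S -> U} := HB.pack Fv Fvm.
(* Both injectivity claims reduce to the triviality of the kernel of the defect operator on the
   closure of its own range. *)
have linj (V : hilbertType R) (f : {linear defect_space S -> V}) :
    (forall v, f v = 0 -> defect_op S (subspace_val v) = 0) -> injective f.
  move=> f0 v w fvw; apply/eqP; rewrite -subr_eq0; apply/eqP/val_inj => /=.
  apply: (Dker _ (subspace_valP (v - w))); apply: (f0 (v - w)).
  by rewrite linearB fvw subrr.
have Dinj : injective Dv' by apply: linj => v /(congr1 (@subspace_val _ _ _)).
have Finj : injective Fv'.
  apply: linj => v Fv0; apply/eqP; rewrite -(dnorm_eq0 dotp) /= -Dsym DD.
  by have /= -> : adjoint F (subspace_val v) = 0 := Fv0; rewrite linear0 linear0l.
(* Here [dim U] equals the dimension of the defect space: [g] inverts [F^*] on all of [U]. *)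
have /choice[g gP] := injective_surjective_dim dD dU Finj.
have gl : linear g.
  by move=> a x y; apply: Finj; rewrite linearP !gP.
have Fg u : Fv (g u) = u := gP u.
have isoD v w : '[Dv v, Dv w] = '[Fv v, Fv w].
  by rewrite subspace_dotE /= Dsym DD -adjointPr.
pose s u := Dv (g u).
have isos x y : '[s x, s y] = '[x, y] by rewrite isoD !Fg.
have sl : linear s by move=> a x y; rewrite /s gl; exact: Dvl.
have [|sigma sE] := bounded_opE sl.
  by exists 1 => u; rewrite mul1r -ler_sqr ?nnegrE// -!dotpxx isos.
exists sigma.
  apply: isometry_surjective_unitary => [x y|w]; first by rewrite !sE.
  have [v vw] := injective_surjective_dim dD dD Dinj w.
  exists (Fv v); rewrite sE -vw /s; congr Dv.
  by apply: Finj; rewrite [LHS]Fg.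
(* For [u = F^* v] one has [F u = F F^* v = D (D v) = D (sigma u)]. *)
by move=> u; rewrite sE /= DD -{1}(Fg u).
Qed.

(** Stated for a single contraction [S]; the row [row_op T] is the instance where [K] is the power
    [hpow d H]. *)
Lemma coisometric_defect_factor {R : realType} {H K U Y : hilbertType R}
    (S : 'B(K, H)) (n : nat) (F : 'B(U, K)) (G : 'B(H, Y)) (E : 'B(U, Y))
    (W : 'B(dsum H U, dsum K Y)) :
  contractive (adjoint S) ->
  has_dim n (defect_space S) ->
  W =1 block_op (adjoint S) F G E ->
  coisometric W ->
  has_dim n U ->
  exists (gamma : 'B(defect_space_star S, Y)) (sigma : 'B(U, defect_space S))
         (T0 : 'B(defect_space S, defect_space_star S)),
    [/\ forall v, subspace_val (T0 v) = S (subspace_val v),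
        coisometric gamma,
        contractive gamma,
        unitary_op sigma
      & W =1 block_op id \0 \0 gamma
             \o block_op (adjoint S)
                         (defect_op S \o @subspace_val _ _ _ \o sigma)
                         (ran_op (defect_op_star S))
                         (\- (T0 \o sigma))].
Proof.
move=> cS dimD WE cW dimU.
have [SF SG GS GE] := coisometric_block_op WE cW.
have {}SF x : adjoint S (S x) + F (adjoint F x) = x by rewrite -[RHS]SF adjointK.
have {}GS x : G (S x) = - E (adjoint F x).
  by apply/eqP; rewrite -addr_eq0; have := GS x; rewrite adjointK => ->.
have {}SG y : adjoint S (adjoint G y) = - F (adjoint E y).
  by apply/eqP; rewrite -addr_eq0 SG.
have [sigma us FE] := defect_polar cS SF dimD dimU.
have [T0 T0E] : exists T0 : 'B(defect_space S, defect_space_star S),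
    forall v, subspace_val (T0 v) = S (subspace_val v).
  by apply: ran_closure_map => x; exists (S x); rewrite defect_op_intertwine.
have [Ts TsE] : exists Ts : 'B(defect_space_star S, defect_space S),
    forall v, subspace_val (Ts v) = adjoint S (subspace_val v).
  by apply: ran_closure_map => x; exists (adjoint S x); rewrite defect_op_star_intertwine.
have [iota iotaE] : exists iota : 'B(defect_space_star S, H),
    iota =1 @subspace_val _ _ _.
  apply: bounded_opE; first by move=> a x y.
  by exists 1 => x; rewrite mul1r subspace_normE.
pose D := defect_op S; pose Ds := defect_op_star S.
pose gamma : 'B(defect_space_star S, Y) := (G \o (Ds \o iota)) \- (E \o (adjoint sigma \o Ts)).
have gammaE v : gamma v = G (Ds (subspace_val v)) - E (adjoint sigma (Ts v)).
  by rewrite /gamma /= iotaE.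
(* Both remaining goals evaluate [gamma] at vectors [D_* x - S w]. The exchange rules and
   [S^* S = 1 - D ^ 2] remove [D_*] from the result. *)
have gammaDs x w : gamma (ran_op Ds x - T0 w) =
    G x - G (S (adjoint S x)) - G (S (D (subspace_val w)))
      - E (adjoint sigma (ran_op D (adjoint S x) - w + ran_op D (D (subspace_val w)))).
  rewrite gammaE; congr (_ - E (adjoint sigma _)).
    rewrite -!linearB; congr (G _).
    rewrite /= T0E linearB /= defect_op_star_sqr//.
    by rewrite /D defect_op_intertwine.
  apply/val_inj => /=; rewrite TsE /= T0E linearB/= defect_op_star_intertwine// -addrA.
  congr (_ + _); rewrite /D defect_op_sqr// addrA addNr add0r.
  by [].
have FsE x : adjoint sigma (ran_op D x) = adjoint F x.
  apply: dotp_ext => u; rewrite -!adjointP FE subspace_dotE /=.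
  by rewrite (defect_op_sym cS).
have [sK Ks] := us.
have adj_gamma y : adjoint gamma y = ran_op Ds (adjoint G y) - T0 (sigma (adjoint E y)).
  apply: (adjoint_eq (B := fun y => ran_op Ds (adjoint G y) - T0 (sigma (adjoint E y)))) => v {}y.
  rewrite gammaE linearBl/= linearBr/= (adjointP G) (adjointP E) (adjointPr sigma).
  congr (_ - _).
    by rewrite /Ds (defect_op_star_sym cS).
  by rewrite !subspace_dotE TsE T0E adjointPr.
(* Here [x = G^* y] and [w = sigma (E^* y)]. By [SG] the terms in [G S F E^* y] cancel, and so do
   those in [D F E^* y]; what is left is [G G^* y + E E^* y = y]. *)
have cgamma y : gamma (adjoint gamma y) = y.
  rewrite adj_gamma gammaDs SG /D -FE -[RHS]GE.
  have -> : ran_op D (- F (adjoint E y)) = - ran_op D (F (adjoint E y)).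
    by apply/val_inj; exact: linearN.
  have -> : - ran_op D (F (adjoint E y)) - sigma (adjoint E y) +
      ran_op D (F (adjoint E y)) = - sigma (adjoint E y).
    by rewrite addrAC addNr add0r.
  have GSN z : G (S (- z)) = - G (S z) by rewrite linearN raddfN.
  have EsN z : E (adjoint sigma (- z)) = - E (adjoint sigma z) by rewrite linearN raddfN.
  have /= sKE := sK (adjoint E y).
  by rewrite GSN EsN sKE !opprK addrK.
exists gamma, sigma, T0; split => //; first exact: coisometric_contractive.
move=> [x u]; rewrite WE /block_op; congr pair; first by rewrite addr0 /= FE.
(* Second row, with [w = sigma u]: by [GS] each term containing [G S] cancels against one containing
   [E F^*], which leaves [G x + E u]. *)
rewrite [RHS]add0r [RHS]gammaDs /D -FE.
have -> : adjoint sigma (ran_op D (adjoint S x) - sigma u + ran_op D (F u)) =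
    adjoint F (adjoint S x) - u + adjoint F (F u).
  by rewrite linearD linearB /= !FsE; have /= -> := sK u.
have -> : E (adjoint F (adjoint S x) - u + adjoint F (F u)) =
    E (adjoint F (adjoint S x)) - E u + E (adjoint F (F u)).
  by rewrite linearD linearB.
by rewrite !GS !opprK [X in _ = _ - X]addrAC opprB -[X in _ = X + _]addrA addrACA subrr addr0.
Qed.

Theorem theorem8p2 (R : realType) (d : nat) (H U Y : hilbertType R)
    (T : 'I_d -> 'B(H, H)) (n : nat)
    (F : 'B(U, hpow d H)) (G : 'B(H, Y)) (E : 'B(U, Y))
    (W : 'B(dsum H U, dsum (hpow d H) Y)) :
  row_contraction T ->
  has_dim n (defect_space (row_op T)) ->
  W =1 block_op (adjoint (row_op T)) F G E ->
  coisometric W ->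
  observable W ->
  has_dim n U ->
  exists (gamma : 'B(defect_space_star (row_op T), Y))
         (sigma : 'B(U, defect_space (row_op T)))
         (T0 : 'B(defect_space (row_op T), defect_space_star (row_op T))),
    [/\ forall v, subspace_val (T0 v) = row_op T (subspace_val v),
        coisometric gamma,
        contractive gamma,
        unitary_op sigma
      & W =1 block_op id \0 \0 gamma
             \o block_op (adjoint (row_op T))
                         (defect_op (row_op T) \o @subspace_val _ _ _ \o sigma)
                         (ran_op (defect_op_star (row_op T)))
                         (\- (T0 \o sigma))].
Proof.
move=> cT dimD WE cW _ dimU.
exact: coisometric_defect_factor (row_contraction_adjoint cT) dimD WE cW dimU.
Qed.
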